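(* For every $h\in(1,2)$ there exist a uniformly continuous, compactly supported, weakly divergence-free velocity field $u\in C_c([0,\infty)\times\mathbb{R}^2;\mathbb{R}^2)$ and a time-dependent locally finite Borel measure $\omega=\omega(t)$ on $\mathbb{R}^2$ such that $\omega$ is weakly advected by $u$ on $[0,T]$ for every $T>0$, $\mathrm{supp}\,\omega(0)=\{(0,0)\}$, and $\dim_H\mathrm{supp}\,\omega(t)=h$ for all $t>0$. Moreover, $u$ is locally Lipschitz on $\big([0,\infty)\times\mathbb{R}^2\big)\setminus\{(0,(0,0))\}$.
   Context: Weak advection (2D): Let $T>0$ and $u\in C([0,T]\times\mathbb{R}^2;\mathbb{R}^2)$ be continuous and weakly divergence free. A family $\mu(t)$, $t\in[0,T]$, of locally finite Borel measures on $\mathbb{R}^2$ is weakly advected by $u$ on $[0,T]$ if for every $\phi\in C_c^\infty([0,T]\times\mathbb{R}^2)$ $$\int_0^T\!\!\int\partial_t\phi(t,x)\,d\mu(t)(x)\,dt-\int\phi(T,x)\,d\mu(T)(x)+\int\phi(0,x)\,d\mu(0)(x)+\int_0^T\!\!\int (u\cdot\nabla)\phi(t,x)\,d\mu(t)(x)\,dt=0.$$ $\dim_H$ denotes Hausdorff dimension. *)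

(* Defs.v *)
From HB Require Import structures.
From mathcomp Require Import all_boot all_order all_algebra.
From mathcomp Require Import all_classical all_reals all_analysis.
Set Implicit Arguments. Unset Strict Implicit. Unset Printing Implicit Defensive.
Import Order.TTheory GRing.Theory Num.Theory.
Import numFieldNormedType.Exports.
Local Open Scope classical_set_scope.
Local Open Scope ring_scope.

(* Points of R^2 are pairs in R * R; space-time points are in R * (R * R),
   with first component the time t. *)

Definition edist {R : realType} (x y : R * R) : R :=
  Num.sqrt ((x.1 - y.1) ^+ 2 + (x.2 - y.2) ^+ 2).

(* Diameter (Euclidean) of a subset of R^2, as an extended real; diam set0 = 0 *)
Definition diam {R : realType} (A : set (R * R)) : \bar R :=
  ereal_sup ([set 0%E] `|` [set (edist x y)%:E | x in A & y in A]).

Definition hausdorff_approx {R : realType} (s delta : R) (A : set (R * R)) : \bar R :=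
  ereal_inf [set (\sum_(0 <= i <oo) ((fine (diam (F i))) `^ s)%:E)%E
            | F in [set F : nat -> set (R * R) |
                     A `<=` \bigcup_i F i /\ (forall i, (diam (F i) <= delta%:E)%E)]].

(* s-dimensional Hausdorff outer measure: limit (= sup) as delta -> 0+ *)
Definition hausdorff_measure {R : realType} (s : R) (A : set (R * R)) : \bar R :=
  ereal_sup [set hausdorff_approx s delta A | delta in [set d : R | 0 < d]].

Definition hausdorff_dim {R : realType} (A : set (R * R)) : \bar R :=
  ereal_inf [set s%:E | s in [set s : R | 0 < s /\ hausdorff_measure s A = 0%E]].

Definition msupp {R : realType} (mu : {measure set (R * R) -> \bar R}) : set (R * R) :=
  [set x | forall U : set (R * R), open U -> U x -> (0 < mu U)%E].

Definition locally_finite {R : realType} (mu : {measure set (R * R) -> \bar R}) : Prop :=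
  forall x : R * R, exists U : set (R * R), [/\ open U, U x & (mu U < +oo)%E].

Definition iterD {R : realType} {V : normedModType R} (vs : seq V) (f : V -> R) : V -> R :=
  foldr (fun v g => 'D_v g) f vs.

Definition smooth {R : realType} {V : normedModType R} (f : V -> R) : Prop :=
  (forall (vs : seq V) (v x : V), derivable (iterD vs f) x v) /\
  (forall vs : seq V, continuous (iterD vs f)).

Definition compact_support {R : realType} {V : normedModType R} {W : normedModType R}
  (f : V -> W) : Prop :=
  exists K : set V, compact K /\ forall x, ~ K x -> f x = 0.

Definition test_fun {R : realType} {V : normedModType R} (f : V -> R) : Prop :=
  smooth f /\ compact_support f.

Definition weakly_div_free {R : realType} (u : R * (R * R) -> R * R) : Prop :=
  forall (t : R), 0 <= t -> forall psi : R * R -> R, test_fun psi ->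
    (\int[(@lebesgue_measure R \x @lebesgue_measure R)%E]_x
        ((u (t, x)).1 * 'D_(1, 0) psi x + (u (t, x)).2 * 'D_(0, 1) psi x)%:E = 0)%E.

Definition dt {R : realType} (phi : R * (R * R) -> R) := 'D_((1 : R), ((0 : R), (0 : R))) phi.
Definition udotgrad {R : realType} (u : R * (R * R) -> R * R) (phi : R * (R * R) -> R)
  (p : R * (R * R)) : R :=
  (u p).1 * 'D_((0 : R), ((1 : R), (0 : R))) phi p +
  (u p).2 * 'D_((0 : R), ((0 : R), (1 : R))) phi p.

Definition weakly_advected {R : realType} (T : R)
  (mu : R -> {measure set (R * R) -> \bar R}) (u : R * (R * R) -> R * R) : Prop :=
  forall phi : R * (R * R) -> R, test_fun phi ->
    let A := fun t => (\int[mu t]_x (dt phi (t, x))%:E)%E in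
    let B := fun t => (\int[mu t]_x (udotgrad u phi (t, x))%:E)%E in
    [/\ lebesgue_measure.-integrable `[0%R, T] A,
        lebesgue_measure.-integrable `[0%R, T] B &
        (\int[lebesgue_measure]_(t in `[0%R, T]) A t
         - \int[mu T]_x (phi (T, x))%:E
         + \int[mu 0%R]_x (phi (0%R, x))%:E
         + \int[lebesgue_measure]_(t in `[0%R, T]) B t = 0)%E].

Definition halfspace {R : realType} : set (R * (R * R)) := [set p | 0 <= p.1].

Definition unif_cont_on {R : realType} (D : set (R * (R * R))) (u : R * (R * R) -> R * R) :=
  forall e : R, 0 < e -> exists2 d : R, 0 < d &
    forall p q, D p -> D q -> `|p - q| < d -> `|u p - u q| < e.

Definition loc_lipschitz_on {R : realType} (D : set (R * (R * R))) (u : R * (R * R) -> R * R) :=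
  forall p, D p -> exists2 r : R, 0 < r & exists L : R,
    forall q q', D q -> D q' -> ball p r q -> ball p r q' ->
      `|u q - u q'| <= L * `|q - q'|.

(* Main.v *)
Require Import Defs.
From HB Require Import structures.
From mathcomp Require Import all_boot all_order all_algebra.
From mathcomp Require Import all_classical all_reals all_analysis.
From mathcomp Require Import measurable_realfun.
From mathcomp Require Import ring lra zify.
Import Order.TTheory GRing.Theory Num.Theory.
Import numFieldNormedType.Exports.
Local Open Scope classical_set_scope.
Local Open Scope ring_scope.

Set Implicit Arguments. Unset Strict Implicit. Unset Printing Implicit Defensive.

(* Fix the ratio l with 4 l^h = 1 and move the Cantor dust
     C(t) = { sum_j a_j(t) e_j : e_j in {0,1}^2 },  a_j(t) = 2^-j min((2l)^j, theta(t)),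
   where theta increases from 0 to 1. For t > 0 all but finitely many a_j equal l^j,
   so C(t) is a union of homothetic copies of the self-similar dust of ratio l, of
   dimension h; and C(0) is the origin. While theta decreases from (2l)^k to
   (2l)^(k+1), backwards in time, the 4^(k+1) pieces of generation k+1 are translated
   rigidly: their corners form a square grid which is shrunk homothetically. Linear
   motion x -> theta' x of the corners is turned into a translation of each piece by
   replacing x with a smoothed staircase Q(x) that is constant on the pieces and
   climbs in the gaps; the field theta' (Q(x), Q(y)) on the dust extends to the
   compactly supported divergence-free field with stream function
   theta' (A(y) Q(x) - A(x) Q(y)), A being a cut-off identity. Stage k takes time
   of order (l + 1/2)^k and moves points by O((2l)^k), so that the field is
   O((2l / (l + 1/2))^k) there: it tends to 0 as t -> 0, while it is Lipschitz away
   from the space-time origin, where only finitely many stages are active.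
   The measure puts a positive mass on each of the countably many points of C(t)
   with a finite digit expansion; these points follow the flow, which gives weak
   advection by the chain rule, and they are dense in C(t). *)

(** * One-variable calculus for piecewise quadratic profiles *)

Section calculus.
Context {R : realType}.
Implicit Types (f g : R -> R) (x y s : R).

(** A remainder bounded by [C * s ^+ 2] makes the difference quotient converge. This form suits
    [C^{1,1}] functions glued from quadratic pieces, which can then be differentiated without
    treating the knots separately. *)
Lemma is_derive_quadratic_remainder f (df C x : R) :
  (forall s, `|f (x + s) - f x - df * s| <= C * s ^+ 2) -> is_derive x 1 f df.
Proof.
move=> fC.
have C0 : 0 <= C by have := fC 1; rewrite expr1n !mulr1 => /(le_trans (normr_ge0 _)).
suff cv : (fun s => s^-1 *: (f (s *: 1 + x) - f x)) @ 0^' --> df.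
  apply: DeriveDef; first by apply/cvg_ex; exists df.
  exact/cvg_lim.
apply/cvgrPdist_le => e e0; near=> s.
have s0 : s != 0 by near: s; exact: nbhs_dnbhs_neq.
have -> : df - s^-1 *: (f (s *: 1 + x) - f x) =
    - (s^-1 * (f (x + s) - f x - df * s)).
  by rewrite /GRing.scale/= mulr1 (addrC s x); field.
rewrite normrN normrM normfV ler_pdivrMl ?normr_gt0//.
apply: le_trans (fC s) _.
rewrite -real_normK ?num_real// expr2 mulrA [leRHS]mulrC ler_wpM2r//.
have : `|s| <= e / (C + 1).
  near: s; apply: dnbhs0_le; rewrite divr_gt0// ltr_wpDl//.
rewrite ler_pdivlMr ?ltr_wpDl// => /(le_trans _); apply.
by rewrite mulrC ler_wpM2l// lerDl.
Unshelve. all: by end_near. Qed.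

Lemma continuous_derive f (df : R -> R) : (forall x, is_derive x 1 f (df x)) ->
  continuous f.
Proof.
by move=> d x; apply: differentiable_continuous; apply/derivable1_diffP; case: (d x).
Qed.

Lemma lipschitz_derive_bounded f (df : R -> R) C :
  (forall x, is_derive x 1 f (df x)) -> (forall x, `|df x| <= C) ->
  forall x y, `|f x - f y| <= C * `|x - y|.
Proof.
move=> d dC.
have H x y : x <= y -> `|f x - f y| <= C * `|x - y|.
  move=> xy; rewrite distrC.
  have cf : {within `[x, y], continuous f}.
    exact: continuous_subspaceT (continuous_derive d).
  have [c _ ->] := @MVT_segment _ f df x y xy (fun z _ => d z) cf.
  by rewrite normrM distrC ler_wpM2r.
move=> x y; case: (leP x y) => [/H//|/ltW /H].
by rewrite distrC (distrC y).
Qed.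

(** The profiles below are all written with arguments of the shape [x * a + b], so that this rule
    applies by unification. *)
Lemma is_derive_affine (f : R -> R) (df a b x : R) :
  is_derive (x * a + b) 1 f df -> is_derive x 1 (fun s => f (s * a + b)) (a * df).
Proof.
move=> dfx.
have d1 : is_derive x 1 (fun s : R => s * a + b) a.
  apply: (@is_derive_quadratic_remainder _ _ 0) => s.
  by rewrite (_ : _ - _ = 0) ?normr0 ?mul0r//; ring.
have := @is_derive1_comp _ f (fun s : R => s * a + b) x df a dfx d1.
by rewrite mulrC.
Qed.

End calculus.

(** * The smooth step from which all profiles are built *)

Section smoothstep.
Context {R : realType}.
Implicit Types (x y s : R).

(* The primitive of a tent function: C^{1,1}, 0 below -1 and 1 above 0. *)
Definition smoothstep s : R := 2 * (Num.max 0 (s + 1) ^+ 2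
  - 2 * Num.max 0 (s + 2^-1) ^+ 2 + Num.max 0 s ^+ 2).

Definition dsmoothstep s : R := 4 * (Num.max 0 (s + 1)
  - 2 * Num.max 0 (s + 2^-1) + Num.max 0 s).

Lemma smoothstep_lo s : s <= -1 -> smoothstep s = 0.
Proof.
by move=> s1; rewrite /smoothstep !max_l; first ring; lra.
Qed.

Lemma dsmoothstep_lo s : s <= -1 -> dsmoothstep s = 0.
Proof.
by move=> s1; rewrite /dsmoothstep !max_l; first ring; lra.
Qed.

Lemma smoothstep_hi s : 0 <= s -> smoothstep s = 1.
Proof.
by move=> s1; rewrite /smoothstep !max_r; first field; lra.
Qed.

Lemma dsmoothstep_hi s : 0 <= s -> dsmoothstep s = 0.
Proof.
by move=> s1; rewrite /dsmoothstep !max_r; first field; lra.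
Qed.

Lemma smoothstep_ge0_le1 s : 0 <= smoothstep s <= 1.
Proof.
rewrite /smoothstep.
case: (leP 0 (s + 1)) => h1; case: (leP 0 (s + 2^-1)) => h2;
  case: (leP 0 s) => h3; apply/andP; split; nra.
Qed.

Lemma dsmoothstep_ge0_le2 s : 0 <= dsmoothstep s <= 2.
Proof.
rewrite /dsmoothstep.
case: (leP 0 (s + 1)) => h1; case: (leP 0 (s + 2^-1)) => h2;
  case: (leP 0 s) => h3; apply/andP; split; lra.
Qed.

Lemma normr_smoothstep s : `|smoothstep s| <= 1.
Proof. by have /andP[a b] := smoothstep_ge0_le1 s; rewrite ger0_norm. Qed.

Lemma normr_dsmoothstep s : `|dsmoothstep s| <= 2.
Proof. by have /andP[a b] := dsmoothstep_ge0_le2 s; rewrite ger0_norm. Qed.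

Lemma is_derive_smoothstep s : is_derive s 1 smoothstep (dsmoothstep s).
Proof.
apply: (@is_derive_quadratic_remainder _ _ _ 8) => r.
rewrite /smoothstep /dsmoothstep ler_norml.
have Q x : - r ^+ 2 <= Num.max 0 (x + r) ^+ 2 - Num.max 0 x ^+ 2 - 2 * Num.max 0 x * r <= r ^+ 2.
  case: (leP 0 (x + r)) => h1; case: (leP 0 x) => h2; apply/andP; split; nra.
have /andP[a1 b1] := Q (s + 1).
have /andP[a2 b2] := Q (s + 2^-1).
have /andP[a3 b3] := Q s.
rewrite !(addrAC s r); apply/andP; split; nra.
Qed.

Lemma dsmoothstep_lip x y : `|dsmoothstep x - dsmoothstep y| <= 16 * `|x - y|.
Proof.
have L (u v : R) : `|Num.max 0 u - Num.max 0 v| <= `|u - v|.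
  case: (leP 0 u) => h1; case: (leP 0 v) => h2; rewrite ?subrr ?normr0 //.
  - by rewrite subr0 !ger0_norm//; lra.
  - by rewrite sub0r normrN ger0_norm// ler0_norm ?opprB; lra.
have := L (x + 1) (y + 1); have := L (x + 2^-1) (y + 2^-1); have := L x y.
have -> : x + 1 - (y + 1) = x - y by ring.
have -> : x + 2^-1 - (y + 2^-1) = x - y by ring.
rewrite /dsmoothstep !ler_norml => /andP[? ?] /andP[? ?] /andP[? ?].
apply/andP; split; lra.
Qed.

Lemma smoothstep_lip x y : `|smoothstep x - smoothstep y| <= 2 * `|x - y|.
Proof.
apply: lipschitz_derive_bounded normr_dsmoothstep _ _ => s.
exact: is_derive_smoothstep.
Qed.

End smoothstep.

(** * An algebra of bounded Lipschitz functions *)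

Section bounded_lipschitz.
Context {R : realType} {V : normedModType R}.
Implicit Types (F G : V -> R).

(** Boundedness is part of the notion because products of Lipschitz functions are Lipschitz only
    when the factors are bounded; a single constant serves both purposes. *)
Definition bounded_lipschitz F := exists B : R,
  (forall p, `|F p| <= B) /\ (forall p q, `|F p - F q| <= B * `|p - q|).

Lemma bounded_lipschitz_ge0 F B (p0 : V) :
  (forall p, `|F p| <= B) -> 0 <= B.
Proof. by move=> /(_ p0); exact: le_trans. Qed.

Lemma bounded_lipschitz_cst (c : R) : bounded_lipschitz (fun=> c).
Proof.
exists `|c|; split => // p q.
by rewrite subrr normr0 mulr_ge0.
Qed.

Lemma bounded_lipschitzD F G : bounded_lipschitz F -> bounded_lipschitz G ->
  bounded_lipschitz (fun p => F p + G p).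
Proof.
move=> [A [A1 A2]] [B [B1 B2]]; exists (A + B); split => [p|p q].
  by rewrite (le_trans (ler_normD _ _))// lerD.
by rewrite opprD addrACA (le_trans (ler_normD _ _))// mulrDl lerD.
Qed.

Lemma bounded_lipschitzN F : bounded_lipschitz F ->
  bounded_lipschitz (fun p => - F p).
Proof.
move=> [A [A1 A2]]; exists A; split => [p|p q]; first by rewrite normrN.
by rewrite -opprD normrN.
Qed.

Lemma bounded_lipschitzB F G : bounded_lipschitz F -> bounded_lipschitz G ->
  bounded_lipschitz (fun p => F p - G p).
Proof. by move=> bF /bounded_lipschitzN; exact: bounded_lipschitzD. Qed.

Lemma bounded_lipschitzM F G : bounded_lipschitz F -> bounded_lipschitz G ->
  bounded_lipschitz (fun p => F p * G p).
Proof.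
move=> [A [A1 A2]] [B [B1 B2]].
have A0 : 0 <= A := bounded_lipschitz_ge0 0 A1.
have B0 : 0 <= B := bounded_lipschitz_ge0 0 B1.
exists (2 * A * B); split => [p|p q].
  rewrite normrM (le_trans (ler_pM _ _ (A1 p) (B1 p)))//.
  by rewrite -mulrA ler_peMl ?mulr_ge0// ler1n.
rewrite (_ : _ - _ = F p * (G p - G q) + (F p - F q) * G q); last by ring.
rewrite (le_trans (ler_normD _ _))// !normrM.
rewrite (_ : _ * `|p - q| = A * (B * `|p - q|) + A * `|p - q| * B); last by ring.
by rewrite lerD// ler_pM.
Qed.

Lemma bounded_lipschitz_sum n (F : nat -> V -> R) :
  (forall i, bounded_lipschitz (F i)) ->
  bounded_lipschitz (fun p => \sum_(i < n) F i p).
Proof.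
move=> bF; elim: n => [|n IH].
  rewrite (_ : (fun p => _) = fun=> 0); first exact: bounded_lipschitz_cst.
  by apply/funext => p; rewrite big_ord0.
rewrite (_ : (fun p => _) = fun p => \sum_(i < n) F i p + F n p).
  exact: bounded_lipschitzD.
by apply/funext => p; rewrite big_ord_recr.
Qed.

Definition lipschitz_fun F := exists L : R, forall p q, `|F p - F q| <= L * `|p - q|.

Lemma lipschitz_funB F G : lipschitz_fun F -> lipschitz_fun G ->
  lipschitz_fun (fun p => F p - G p).
Proof.
move=> [A A2] [B B2]; exists (A + B) => p q.
rewrite opprD addrACA -opprD (le_trans (ler_normD _ _))// mulrDl normrN.
by rewrite lerD.
Qed.

Lemma lipschitz_funMr F (c : R) : lipschitz_fun F -> lipschitz_fun (fun p => F p * c).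
Proof.
move=> [A A2]; exists (A * `|c|) => p q.
by rewrite -mulrBl normrM mulrAC ler_wpM2r.
Qed.

Lemma bounded_lipschitz_fun F : bounded_lipschitz F -> lipschitz_fun F.
Proof. by move=> [B [_ BF]]; exists B. Qed.

Lemma lipschitz_cst (c : R) : lipschitz_fun (fun=> c).
Proof. exact/bounded_lipschitz_fun/bounded_lipschitz_cst. Qed.

(** Only the outer function has to be bounded, so the inner one can be an unbounded coordinate. *)
Lemma bounded_lipschitz_comp (g : R -> R) (f : V -> R) B L :
  (forall s, `|g s| <= B) -> (forall s r, `|g s - g r| <= L * `|s - r|) ->
  lipschitz_fun f -> bounded_lipschitz (fun p => g (f p)).
Proof.
move=> gB0 gL0 [L' fL].
have B0' : 0 <= B by apply: le_trans (gB0 0).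
have L0' : 0 <= L by have := gL0 1 0; rewrite subr0 normr1 mulr1; exact: le_trans.
have gB s : `|g s| <= B + L by rewrite (le_trans (gB0 s))// lerDl.
have gL s r : `|g s - g r| <= (B + L) * `|s - r|.
  by rewrite (le_trans (gL0 s r))// ler_wpM2r// lerDr.
move: (B + L) gB gL => {gB0 gL0 B0' L0'}C gB gL; move: L' fL => {}L fL; move: C gB gL => {}B gB gL.
have B0 : 0 <= B by apply: le_trans (gB 0).
exists (B + B * `|L|); split => [p|p q].
  by rewrite (le_trans (gB _))// lerDl mulr_ge0.
rewrite (le_trans (gL _ _))//.
apply: (@le_trans _ _ (B * (`|L| * `|p - q|))).
  rewrite ler_wpM2l// (le_trans (fL _ _))// ler_wpM2r// ler_norm//.
by rewrite mulrDl mulrA lerDr mulr_ge0.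
Qed.

End bounded_lipschitz.

(** Applied to the steps of a staircase, whose transition layers are disjoint in space, and to the
    stages, which are disjoint in time. *)
Lemma sum_at_most_one {R : realType} n (f : nat -> R) B : 0 <= B ->
  (forall i, `|f i| <= B) ->
  (forall i j, f i != 0 -> f j != 0 -> i = j) -> `|\sum_(i < n) f i| <= B.
Proof.
move=> B0 fB f1; case: (pickP (fun i : 'I_n => f i != 0)) => [i0 fi0|f0].
  rewrite (bigD1 i0)//= big1 ?addr0// => i ii0; apply/eqP.
  by apply: contraNT ii0 => fi; apply/eqP/val_inj/f1.
by rewrite big1 ?normr0// => i _; apply/eqP; have := f0 i; case: eqP.
Qed.

(** * The velocity field *)

Section velocity.
Context {R : realType} (l : R) (l0 : 0 < l) (l1 : l < 2^-1).
Implicit Types (k : nat) (t x y s : R).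

(* [l] is the contraction ratio of the dust. Stage [k] is the time interval
   from [tim k.+1] to [tim k]; its motion lives at spatial scale [scl k]. *)
Definition scl k : R := (2 * l) ^+ k.
Definition tim k : R := (l + 2^-1) ^+ k.
Definition dtim k : R := tim k - tim k.+1.
Definition dscl k : R := scl k - scl k.+1.
Definition ramp k t : R := smoothstep (t * (dtim k)^-1 - tim k / dtim k).
Definition dramp k t : R :=
  (dtim k)^-1 * dsmoothstep (t * (dtim k)^-1 - tim k / dtim k).
(* Decreases from [scl k] to [scl k.+1] as [t] goes backwards through stage [k]:
   the factor by which the grid of dust pieces is shrunk. *)
Definition spread k t : R := scl k.+1 + dscl k * ramp k t.
Definition dspread k t : R := dscl k * dramp k t.
(* During stage [k] the dust is made of pieces of side at most
   [l ^+ k.+1 / (1 - l)] with lower left corners on the grid of step [cell k t];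
   since [cell k t >= 2 * l ^+ k.+1], consecutive pieces are separated by a gap
   of at least [wid k]. *)
Definition cell k t : R := (2 ^+ k)^-1 * spread k t.
Definition wid k : R := l ^+ k.+1 * ((1 - 2 * l) / (1 - l)).
Definition stair_arg k t x (i : nat) : R :=
  x * (wid k)^-1 - i.+1%:R * cell k t / wid k.
(* Equal to [m / 2 ^+ k] on the piece number [m], see [stair_plateau]; it jumps
   only inside the gaps. *)
Definition stair k t x : R :=
  (2 ^+ k)^-1 * \sum_(i < 2 ^ k.+1) smoothstep (stair_arg k t x i).
Definition dstair k t x : R := (2 ^+ k)^-1 *
  \sum_(i < 2 ^ k.+1) (wid k)^-1 * dsmoothstep (stair_arg k t x i).
(** Equal to 1 on [[- scl k, 3 * scl k]], which contains the range of the dust at stage [k], and to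
    0 outside [[- 2 * scl k, 4 * scl k]]. The support shrinks to the origin as [k] grows. *)
Definition cut k x : R :=
  smoothstep (x * (scl k)^-1 + 1) - smoothstep (x * (scl k)^-1 - 4).
Definition dcut k x : R := (scl k)^-1 * dsmoothstep (x * (scl k)^-1 + 1)
  - (scl k)^-1 * dsmoothstep (x * (scl k)^-1 - 4).
Definition lin k x : R := cut k x * x.
Definition dlin k x : R := dcut k x * x + cut k x.
Definition step k t x : R := cut k x * stair k t x.
Definition dstep k t x : R := dcut k x * stair k t x + cut k x * dstair k t x.
(* First component of the skew gradient of the stream function
   [dspread k t * (lin k y * step k t x - lin k x * step k t y)]; the second one
   is obtained by exchanging [x] and [y]. On a product of two pieces it is
   constant, equal to the velocity of the corner (see [vel_plateau]). *)
Definition vel k t x y : R :=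
  dspread k t * (dlin k y * step k t x - lin k x * dstep k t y).

(* [lra] does not see the section hypotheses. *)
Ltac slra := move: (l0) (l1) => ? ?; lra.

(** * Estimates for a single stage *)

Let l1' : 0 < 1 - l. Proof. by slra. Qed.
Let l2' : 0 < 1 - 2 * l. Proof. by slra. Qed.

Lemma scl_gt0 k : 0 < scl k.
Proof. by rewrite exprn_gt0// mulr_gt0. Qed.

Lemma sclS k : scl k.+1 = 2 * l * scl k.
Proof. by rewrite /scl exprS. Qed.

Lemma scl_anti m n : (m <= n)%N -> scl n <= scl m.
Proof.
by move=> mn; rewrite /scl ler_wiXn2l//; slra.
Qed.

Lemma tim_gt0 k : 0 < tim k.
Proof. by rewrite exprn_gt0//; slra. Qed.

Lemma timS k : tim k.+1 = (l + 2^-1) * tim k.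
Proof. by rewrite /tim exprS. Qed.

Lemma tim_anti m n : (m <= n)%N -> tim n <= tim m.
Proof.
by move=> mn; rewrite /tim ler_wiXn2l//; slra.
Qed.

Lemma dtimE k : dtim k = (2^-1 - l) * tim k.
Proof. by rewrite /dtim timS; field. Qed.

Lemma dtim_gt0 k : 0 < dtim k.
Proof. by rewrite dtimE mulr_gt0 ?tim_gt0//; slra. Qed.

Lemma dsclE k : dscl k = (1 - 2 * l) * scl k.
Proof. by rewrite /dscl sclS; ring. Qed.

Lemma dscl_gt0 k : 0 < dscl k.
Proof. by rewrite dsclE mulr_gt0 ?scl_gt0. Qed.

Lemma wid_gt0 k : 0 < wid k.
Proof. by rewrite mulr_gt0 ?exprn_gt0// divr_gt0. Qed.

Lemma ramp_lo k t : t <= tim k.+1 -> ramp k t = 0.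
Proof.
move=> tk; apply: smoothstep_lo.
by rewrite -mulrBl ler_pdivrMr ?dtim_gt0// /dtim; slra.
Qed.

Lemma ramp_hi k t : tim k <= t -> ramp k t = 1.
Proof.
move=> tk; apply: smoothstep_hi.
by rewrite -mulrBl mulr_ge0 ?subr_ge0// invr_ge0 ltW// dtim_gt0.
Qed.

Lemma dspread_eq0 k t : t <= tim k.+1 \/ tim k <= t -> dspread k t = 0.
Proof.
move=> tk; rewrite /dspread /dramp.
suff -> : dsmoothstep (t / dtim k - tim k / dtim k) = 0 by rewrite !mulr0.
case: tk => tk.
  apply: dsmoothstep_lo.
  by rewrite -mulrBl ler_pdivrMr ?dtim_gt0// /dtim; slra.
apply: dsmoothstep_hi.
by rewrite -mulrBl mulr_ge0 ?subr_ge0// invr_ge0 ltW// dtim_gt0.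
Qed.

Lemma dspread_neq0 k t : dspread k t != 0 -> tim k.+1 < t < tim k.
Proof.
move=> d0; apply/andP; split; rewrite ltNge; apply: contraNN d0 => h;
  by rewrite dspread_eq0//; first [by left|by right].
Qed.

(** Stage [k] is active only in the open interval from [tim k.+1] to [tim k], and these intervals
    are disjoint. *)
Lemma dspread_inj j k t : dspread j t != 0 -> dspread k t != 0 -> j = k.
Proof.
move=> /dspread_neq0/andP[a b] /dspread_neq0/andP[c d].
have H m n : (m < n)%N -> tim m.+1 < t -> t < tim n -> False.
  by move=> mn h1 h2; have := tim_anti mn; slra.
by case: (ltngtP j k) => // [/H|/H] /(_ _) F; exfalso; apply: F.
Qed.

Lemma is_derive_ramp k t : is_derive t 1 (ramp k) (dramp k t).
Proof. exact/is_derive_affine/is_derive_smoothstep. Qed.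

Lemma ramp_ge0_le1 k t : 0 <= ramp k t <= 1.
Proof. exact: smoothstep_ge0_le1. Qed.

Lemma spread_ge k t : scl k.+1 <= spread k t.
Proof.
have /andP[a _] := ramp_ge0_le1 k t.
by rewrite lerDl mulr_ge0// ltW// dscl_gt0.
Qed.

Lemma spread_le k t : spread k t <= scl k.
Proof.
have /andP[_ a] := ramp_ge0_le1 k t.
rewrite /spread -lerBrDl -/(dscl k) ler_piMr// ltW// dscl_gt0//.
Qed.

Lemma cell_ge k t : 2 * l ^+ k.+1 <= cell k t.
Proof.
rewrite /cell ler_pdivlMl ?exprn_gt0//.
apply: le_trans (spread_ge _ _); rewrite /scl exprMn (exprS 2).
by rewrite mulrA (mulrC _ 2).
Qed.

Lemma wid_le_cell k t : wid k <= cell k t.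
Proof.
apply: le_trans (cell_ge k t); rewrite mulrC /wid ler_wpM2l ?exprn_ge0 ?(ltW l0)//.
by rewrite ler_pdivrMr//; slra.
Qed.

Lemma stair_ge0_le2 k t x : 0 <= stair k t x <= 2.
Proof.
rewrite /stair mulr_ge0 ?invr_ge0 ?exprn_ge0//=; last first.
  by apply: sumr_ge0 => i _; have /andP[] := smoothstep_ge0_le1 (stair_arg k t x i).
rewrite ler_pdivrMl ?exprn_gt0//.
apply: (@le_trans _ _ (\sum_(i < 2 ^ k.+1) 1)).
  by apply: ler_sum => i _; have /andP[] := smoothstep_ge0_le1 (stair_arg k t x i).
by rewrite sumr_const card_ord natrX exprSr.
Qed.

(** Consecutive steps are [cell k t] apart, which is at least the width [wid k] of a transition,
    that is 1 in the rescaled variable. *)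
Lemma stair_arg_step k t x i j : (i < j)%N ->
  stair_arg k t x j <= stair_arg k t x i - 1.
Proof.
move=> ij; rewrite /stair_arg -addrA lerD2l -opprD lerN2 -lerBrDl -mulrBl.
rewrite ler_pdivlMr ?wid_gt0// mul1r -mulrBl (le_trans (wid_le_cell k t))//.
rewrite ler_peMl//; first exact: le_trans (ltW (wid_gt0 k)) (wid_le_cell k t).
by rewrite -natrB ?ler1n ?subn_gt0// ltnW.
Qed.

(* The transition layers of the steps are disjoint, so the slope of the staircase
   is that of a single step. *)
Lemma dstair_bound k t x : `|dstair k t x| <= 2 / (l * ((1 - 2 * l) / (1 - l))) / scl k.
Proof.
rewrite /dstair normrM ger0_norm ?invr_ge0 ?exprn_ge0//.
have -> : 2 / (l * ((1 - 2 * l) / (1 - l))) / scl k = (2 ^+ k)^-1 * (2 / wid k).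
  rewrite /wid /scl exprMn (exprS l); field.
  by rewrite !lt0r_neq0 ?exprn_gt0//; slra.
rewrite ler_wpM2l ?invr_ge0 ?exprn_ge0//.
apply: (@sum_at_most_one _ _
    (fun i => (wid k)^-1 * dsmoothstep (stair_arg k t x i))) => [|i|i j].
- by rewrite divr_ge0// ltW ?wid_gt0.
- rewrite normrM normfV (gtr0_norm (wid_gt0 k)) mulrC.
  by rewrite ler_wpM2r ?invr_ge0 ?(ltW (wid_gt0 k))// normr_dsmoothstep.
- have H a : (wid k)^-1 * dsmoothstep (stair_arg k t x a) != 0 ->
      -1 < stair_arg k t x a < 0.
    move=> h; apply/andP; split; rewrite ltNge; apply: contraNN h => h.
      by rewrite dsmoothstep_lo// mulr0.
    by rewrite dsmoothstep_hi// mulr0.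
  move=> /H/andP[a1 a2] /H/andP[b1 b2].
  case: (ltngtP i j) => // ij; exfalso.
    by have := stair_arg_step k t x ij; slra.
  by have := stair_arg_step k t x ij; slra.
Qed.

(* Speed at stage [k] is of order [scl k / tim k = crate ^+ k]. *)
Definition crate : R := 2 * l / (l + 2^-1).
Definition cstair : R := 2 / (l * ((1 - 2 * l) / (1 - l))).

Lemma crate_gt0 : 0 < crate.
Proof. by rewrite divr_gt0//; slra. Qed.

(** The ratio [l + 2^-1] of the stage times is the mean of [2 * l] and 1, so it exceeds the ratio
    [2 * l] of the scales: durations decay more slowly than distances. *)
Lemma crate_lt1 : crate < 1.
Proof. by rewrite ltr_pdivrMr; slra. Qed.

Lemma cstair_gt0 : 0 < cstair.
Proof. by rewrite divr_gt0// mulr_gt0// divr_gt0. Qed.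

Lemma dspread_bound k t : `|dspread k t| <= 4 * crate ^+ k.
Proof.
rewrite /dspread /dramp normrM normrM (gtr0_norm (dscl_gt0 k)) normfV.
rewrite (gtr0_norm (dtim_gt0 k)) mulrA.
(* The factors [1 - 2 * l] of [dscl] and [2^-1 - l] of [dtim] have quotient 2. *)
have -> : dscl k / dtim k = 2 * crate ^+ k.
  rewrite dsclE dtimE /crate exprMn exprVn -/(scl k) -/(tim k); field.
  by rewrite lt0r_neq0 ?tim_gt0//=; slra.
rewrite (_ : 4 * _ = 2 * crate ^+ k * 2); last by ring.
rewrite ler_wpM2l ?normr_dsmoothstep//.
by rewrite mulr_ge0 ?exprn_ge0 ?(ltW crate_gt0).
Qed.

Lemma cut_out k x : x <= - 2 * scl k \/ 4 * scl k <= x -> cut k x = 0 /\ dcut k x = 0.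
Proof.
have s0 := scl_gt0 k; rewrite /cut /dcut => h.
have [h1|h1] : x / scl k <= -2 \/ 4 <= x / scl k.
  by case: h => h; [left; rewrite ler_pdivrMr|right; rewrite ler_pdivlMr].
- by rewrite !smoothstep_lo ?dsmoothstep_lo; slra.
- by rewrite !smoothstep_hi ?dsmoothstep_hi; slra.
Qed.

Lemma cut_in k x : 0 <= x -> x <= 2 * scl k -> cut k x = 1 /\ dcut k x = 0.
Proof.
have s0 := scl_gt0 k; rewrite /cut /dcut => x0 x2.
have h1 : x / scl k <= 2 by rewrite ler_pdivrMr.
have h2 : 0 <= x / scl k by rewrite divr_ge0// ltW.
have h3 : 0 <= x / scl k + 1 by slra.
have h4 : x / scl k - 4 <= -1 by slra.
by rewrite smoothstep_hi// dsmoothstep_hi// smoothstep_lo// dsmoothstep_lo//; split; ring.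
Qed.

Lemma cut_bound k x : `|cut k x| <= 1.
Proof.
rewrite /cut; have := smoothstep_ge0_le1 (x / scl k + 1).
have := smoothstep_ge0_le1 (x / scl k - 4) => /andP[? ?] /andP[? ?].
by rewrite ler_norml; apply/andP; split; slra.
Qed.

Lemma dcut_bound k x : `|dcut k x| <= 2 / scl k.
Proof.
have s0 := scl_gt0 k.
rewrite /dcut -mulrBr normrM mulrC normfV (gtr0_norm s0).
rewrite ler_wpM2r ?invr_ge0 ?(ltW s0)//.
have := dsmoothstep_ge0_le2 (x / scl k + 1).
have := dsmoothstep_ge0_le2 (x / scl k - 4) => /andP[? ?] /andP[? ?].
by rewrite ler_norml; apply/andP; split; slra.
Qed.

Definition outside k x := x <= - 2 * scl k \/ 4 * scl k <= x.

Lemma notin_outside k x : ~ outside k x -> `|x| <= 4 * scl k.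
Proof.
have s0 := scl_gt0 k.
rewrite /outside => /not_orP[/negP + /negP]; rewrite -!ltNge => a b.
by rewrite ler_norml; apply/andP; split; slra.
Qed.

Lemma lin_out k x : outside k x -> lin k x = 0 /\ dlin k x = 0.
Proof. by move/cut_out => [a b]; rewrite /lin /dlin a b; split; ring. Qed.

Lemma step_out k t x : outside k x -> step k t x = 0 /\ dstep k t x = 0.
Proof. by move/cut_out => [a b]; rewrite /step /dstep a b; split; ring. Qed.

Lemma lin_bound k x : `|lin k x| <= 4 * scl k.
Proof.
have s0 := scl_gt0 k.
have [/lin_out[-> _]|/notin_outside h] := pselect (outside k x).
  by rewrite normr0 mulr_ge0// ltW.
by rewrite normrM -[leRHS]mul1r ler_pM// cut_bound.
Qed.

Lemma dlin_bound k x : `|dlin k x| <= 9.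
Proof.
have s0 := scl_gt0 k.
have [/lin_out[_ ->]|/notin_outside h] := pselect (outside k x).
  by rewrite normr0.
rewrite /dlin (le_trans (ler_normD _ _))//.
rewrite (_ : 9 = 8 + 1); last by ring.
rewrite lerD ?cut_bound// normrM.
rewrite (_ : 8 = (2 / scl k) * (4 * scl k)); last by field; rewrite lt0r_neq0.
by rewrite ler_pM// dcut_bound.
Qed.

Lemma stair_bound k t x : `|stair k t x| <= 2.
Proof. by have /andP[a b] := stair_ge0_le2 k t x; rewrite ger0_norm. Qed.

Lemma step_bound k t x : `|step k t x| <= 2.
Proof.
by rewrite normrM -[leRHS]mul1r ler_pM// ?cut_bound// stair_bound.
Qed.

Lemma dstep_bound k t x : `|dstep k t x| <= (4 + cstair) / scl k.
Proof.
have s0 := scl_gt0 k.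
rewrite /dstep (le_trans (ler_normD _ _))// (normrM (dcut k x)) (normrM (cut k x)).
rewrite mulrDl lerD//.
  rewrite (_ : 4 / scl k = 2 / scl k * 2); last by ring.
  by rewrite ler_pM// ?dcut_bound// stair_bound.
by rewrite -[leRHS]mul1r ler_pM// ?cut_bound// dstair_bound.
Qed.

Definition cvel : R := 4 * (18 + 4 * (4 + cstair)).

Lemma cvel_ge0 : 0 <= cvel.
Proof. by rewrite /cvel; have := cstair_gt0; slra. Qed.

(** The factor [scl k] in the bound of [lin] cancels its inverse in the bound of [dstep], so the
    size of the stage comes from [dspread] alone; 18 is the product of the bounds 9 of [dlin] and 2
    of [step]. *)
Lemma vel_bound k t x y : `|vel k t x y| <= cvel * crate ^+ k.
Proof.
have s0 := scl_gt0 k.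
rewrite /vel normrM (_ : cvel * _ = 4 * crate ^+ k * (18 + 4 * (4 + cstair)));
  last by rewrite /cvel; ring.
rewrite ler_pM ?dspread_bound// (le_trans (ler_normB _ _))// lerD//.
  rewrite (_ : 18 = 9 * 2); last by ring.
  by rewrite normrM ler_pM// ?dlin_bound// step_bound.
rewrite (_ : 4 * (4 + cstair) = (4 * scl k) * ((4 + cstair) / scl k)); last first.
  by field; rewrite lt0r_neq0.
by rewrite normrM ler_pM// ?lin_bound// dstep_bound.
Qed.

Lemma vel_out k t x y : outside k x \/ outside k y -> vel k t x y = 0.
Proof.
rewrite /vel => -[] h; have [a b] := lin_out h; have [c d] := step_out t h.
  by rewrite a c; ring.
by rewrite b d; ring.
Qed.

(** * Derivatives of the profiles and their plateaus *)

Lemma is_derive_cut k x : is_derive x 1 (cut k) (dcut k x).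
Proof.
rewrite /cut /dcut; apply: is_deriveB;
  exact/is_derive_affine/is_derive_smoothstep.
Qed.

Lemma is_derive_lin k x : is_derive x 1 (lin k) (dlin k x).
Proof.
have := @is_deriveM _ _ (cut k) id x 1 _ _ (is_derive_cut k x) (is_derive_id x 1).
by move=> H; apply: (is_derive_eq H); rewrite /dlin /GRing.scale/= mulr1 addrC mulrC.
Qed.

Lemma is_derive_stair k t x : is_derive x 1 (stair k t) (dstair k t x).
Proof.
have h (i : 'I_(2 ^ k.+1)) : is_derive x 1 (fun x => smoothstep (stair_arg k t x i))
    ((wid k)^-1 * dsmoothstep (stair_arg k t x i)).
  exact/is_derive_affine/is_derive_smoothstep.
have := @is_derive_sum _ _ _ _ _ _ _ _ h.
move=> /(@is_deriveZ _ _ _ _ ((2 ^+ k)^-1) _ _ _).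
rewrite /stair; set F := (X in is_derive _ _ X _).
suff -> : F = (fun x => (2 ^+ k)^-1 * \sum_(i < 2 ^ k.+1) smoothstep (stair_arg k t x i)) by [].
by apply/funext => z; rewrite /F/= /GRing.scale/= fct_sumE.
Qed.

Lemma is_derive_step k t x : is_derive x 1 (step k t) (dstep k t x).
Proof.
have := @is_deriveM _ _ (cut k) (stair k t) x 1 _ _ (is_derive_cut k x) (is_derive_stair k t x).
by move=> H; apply: (is_derive_eq H); rewrite /dstep /GRing.scale/= addrC mulrC.
Qed.

Lemma cell_gt0 k t : 0 < cell k t.
Proof. exact: lt_le_trans (wid_gt0 k) (wid_le_cell k t). Qed.

Lemma stair_plateau k t (m : nat) r : (m < 2 ^ k.+1)%N -> 0 <= r ->
  r + wid k <= cell k t ->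
  stair k t (m%:R * cell k t + r) = m%:R / 2 ^+ k /\
  dstair k t (m%:R * cell k t + r) = 0.
Proof.
move=> mk r0 rw; have w0 := wid_gt0 k; have c0 := cell_gt0 k t.
have argE i : stair_arg k t (m%:R * cell k t + r) i =
    ((m%:R - i.+1%:R) * cell k t + r) / wid k by rewrite /stair_arg; ring.
have hi i : (i < m)%N -> 0 <= stair_arg k t (m%:R * cell k t + r) i.
  move=> im; rewrite argE divr_ge0 ?(ltW w0)// addr_ge0// mulr_ge0 ?(ltW c0)//.
  by rewrite subr_ge0 ler_nat.
have lo i : (m <= i)%N -> stair_arg k t (m%:R * cell k t + r) i <= -1.
  move=> im; rewrite argE ler_pdivrMr//.
  have : (m%:R - i.+1%:R) * cell k t <= -1 * cell k t.
    rewrite ler_wpM2r ?(ltW c0)// -natr1.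
    have mi : m%:R <= i%:R :> R by rewrite ler_nat.
    slra.
  slra.
split.
  rewrite /stair mulrC; congr (_ * _).
  rewrite (eq_bigr (fun i : 'I_(2 ^ k.+1) => if (i < m)%N then 1 else 0)); last first.
    move=> i _; case: ltnP => im; first by rewrite smoothstep_hi ?hi.
    by rewrite smoothstep_lo ?lo.
  rewrite -big_mkcond/= -(big_ord_widen _ (fun=> 1) (ltnW mk)).
  by rewrite sumr_const card_ord.
rewrite /dstair big1 ?mulr0// => i _.
case: (ltnP i m) => im; first by rewrite dsmoothstep_hi ?hi// mulr0.
by rewrite dsmoothstep_lo ?lo// mulr0.
Qed.

(** Both cut-offs are locally 1 and the staircase in [y] is flat there, so only the product of
    [dlin k y = 1] and the staircase in [x] survives. *)
Lemma vel_plateau k t (m n : nat) r s : (m < 2 ^ k.+1)%N -> (n < 2 ^ k.+1)%N ->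
  0 <= r -> r + wid k <= cell k t -> 0 <= s -> s + wid k <= cell k t ->
  vel k t (m%:R * cell k t + r) (n%:R * cell k t + s) =
  dspread k t * (m%:R / 2 ^+ k).
Proof.
move=> mk nk r0 rw s0 sw.
have H (i : nat) z : (i < 2 ^ k.+1)%N -> 0 <= z -> z + wid k <= cell k t ->
    0 <= i%:R * cell k t + z /\ i%:R * cell k t + z <= 2 * scl k.
  move=> ik z0 zw; have c0 := cell_gt0 k t; have w0 := wid_gt0 k; split.
    by rewrite addr_ge0// mulr_ge0// ltW.
  apply: (@le_trans _ _ (2 ^+ k.+1 * cell k t)).
    apply: (@le_trans _ _ (i.+1%:R * cell k t)); first by rewrite -natr1; slra.
    by rewrite ler_wpM2r ?(ltW c0)// -natrX ler_nat.
  rewrite /cell exprS mulrA mulrK ?unitfE ?lt0r_neq0 ?exprn_gt0//.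
  by rewrite ler_wpM2l// spread_le.
have [a b] := stair_plateau mk r0 rw.
have [a' b'] := stair_plateau nk s0 sw.
have [x0 x1] := H _ _ mk r0 rw; have [y0 y1] := H _ _ nk s0 sw.
have [cx dx] := cut_in x0 x1; have [cy dy] := cut_in y0 y1.
by rewrite /vel /dlin /step /lin /dstep a a' b' cx cy dy; ring.
Qed.

(** * Lipschitz dependence of one stage on time and position *)

Section lipschitz.
Context {V : normedModType R} (T X Y : V -> R).
Hypothesis (hT : lipschitz_fun T) (hX : lipschitz_fun X) (hY : lipschitz_fun Y).

(** Time and coordinates enter as arbitrary Lipschitz functions: the projections of space-time, with
    the coordinates in either order, or a constant time when only the space variable moves. *)
Lemma bounded_lipschitz_ramp k : bounded_lipschitz (fun p => ramp k (T p)).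
Proof.
apply: (@bounded_lipschitz_comp _ _ smoothstep
  (fun p => T p * (dtim k)^-1 - tim k / dtim k)).
- exact: normr_smoothstep.
- exact: smoothstep_lip.
- exact: (lipschitz_funB (lipschitz_funMr _ hT) (lipschitz_cst _)).
Qed.

Lemma bounded_lipschitz_dspread k : bounded_lipschitz (fun p => dspread k (T p)).
Proof.
do 2 (apply: bounded_lipschitzM; first exact: bounded_lipschitz_cst).
apply: (@bounded_lipschitz_comp _ _ dsmoothstep
  (fun p => T p * (dtim k)^-1 - tim k / dtim k)).
- exact: normr_dsmoothstep.
- exact: dsmoothstep_lip.
- exact: (lipschitz_funB (lipschitz_funMr _ hT) (lipschitz_cst _)).
Qed.

Lemma bounded_lipschitz_cell k : bounded_lipschitz (fun p => cell k (T p)).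
Proof.
apply: bounded_lipschitzM; first exact: bounded_lipschitz_cst.
apply: bounded_lipschitzD; first exact: bounded_lipschitz_cst.
apply: bounded_lipschitzM; first exact: bounded_lipschitz_cst.
exact: bounded_lipschitz_ramp.
Qed.

Lemma lipschitz_stair_arg k i : lipschitz_fun (fun p => stair_arg k (T p) (X p) i).
Proof.
apply: lipschitz_funB; first exact: lipschitz_funMr.
apply/bounded_lipschitz_fun/bounded_lipschitzM; last exact: bounded_lipschitz_cst.
apply: bounded_lipschitzM; last exact: bounded_lipschitz_cell.
exact: bounded_lipschitz_cst.
Qed.

Lemma bounded_lipschitz_stair k : bounded_lipschitz (fun p => stair k (T p) (X p)).
Proof.
apply: bounded_lipschitzM; first exact: bounded_lipschitz_cst.
apply: (@bounded_lipschitz_sum _ _ _ (fun i p => smoothstep (stair_arg k (T p) (X p) i))).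
move=> i; apply: bounded_lipschitz_comp (lipschitz_stair_arg k i).
- exact: normr_smoothstep.
- exact: smoothstep_lip.
Qed.

Lemma bounded_lipschitz_dstair k : bounded_lipschitz (fun p => dstair k (T p) (X p)).
Proof.
apply: bounded_lipschitzM; first exact: bounded_lipschitz_cst.
apply: (@bounded_lipschitz_sum _ _ _
  (fun i p => (wid k)^-1 * dsmoothstep (stair_arg k (T p) (X p) i))).
move=> i; apply: bounded_lipschitzM; first exact: bounded_lipschitz_cst.
apply: bounded_lipschitz_comp (lipschitz_stair_arg k i).
- exact: normr_dsmoothstep.
- exact: dsmoothstep_lip.
Qed.

Lemma bounded_lipschitz_cut k : bounded_lipschitz (fun p => cut k (X p)).
Proof.
apply: (@bounded_lipschitz_comp _ _ (cut k) X 1 (2 / scl k)) => // [s|].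
  exact: cut_bound.
by apply: lipschitz_derive_bounded (dcut_bound k) => s; exact: is_derive_cut.
Qed.

Lemma bounded_lipschitz_dcut k : bounded_lipschitz (fun p => dcut k (X p)).
Proof.
apply: bounded_lipschitzB; (apply: bounded_lipschitzM; first exact: bounded_lipschitz_cst).
- apply: (@bounded_lipschitz_comp _ _ dsmoothstep (fun p => X p * (scl k)^-1 + 1)).
  + exact: normr_dsmoothstep.
  + exact: dsmoothstep_lip.
  + have := lipschitz_funB (lipschitz_funMr (scl k)^-1 hX) (lipschitz_cst (-1)).
    by under eq_fun do rewrite opprK.
- apply: (@bounded_lipschitz_comp _ _ dsmoothstep (fun p => X p * (scl k)^-1 - 4)).
  + exact: normr_dsmoothstep.
  + exact: dsmoothstep_lip.
  + exact: (lipschitz_funB (lipschitz_funMr (scl k)^-1 hX) (lipschitz_cst _)).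
Qed.

Lemma bounded_lipschitz_lin k : bounded_lipschitz (fun p => lin k (X p)).
Proof.
apply: (@bounded_lipschitz_comp _ _ (lin k) X (4 * scl k) 9) => // [s|].
  exact: lin_bound.
by apply: lipschitz_derive_bounded (dlin_bound k) => s; exact: is_derive_lin.
Qed.

(** The factor [x] in [dcut k x * x] is unbounded, but it can be truncated at [4 * scl k] without
    changing the product, since [dcut k] vanishes beyond. *)
Lemma bounded_lipschitz_dlin k : bounded_lipschitz (fun p => dlin k (X p)).
Proof.
have s0 := scl_gt0 k.
pose clamp x := Num.max (- (4 * scl k)) (Num.min (4 * scl k) x).
have -> : (fun p => dlin k (X p)) = fun p => dcut k (X p) * clamp (X p) + cut k (X p).
  apply/funext => p; rewrite /dlin.
  have [/cut_out[_ ->]|/notin_outside h] := pselect (outside k (X p)).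
    by rewrite !mul0r.
  congr (_ * _ + _); move: h; rewrite ler_norml => /andP[h1 h2].
  by rewrite /clamp min_r// max_r.
apply: bounded_lipschitzD (bounded_lipschitz_cut k).
apply: bounded_lipschitzM; first exact: bounded_lipschitz_dcut.
apply: (@bounded_lipschitz_comp _ _ clamp X (4 * scl k) 1) => // [s|s r]; rewrite /clamp ?mul1r.
- rewrite ler_norml; apply/andP; split; first by rewrite le_max lexx.
  by rewrite ge_max ge_min lexx andbT; slra.
- have mx (a u v : R) : `|Num.max a u - Num.max a v| <= `|u - v|.
    have := ler_norm (u - v); have := ler_norm (v - u); rewrite (distrC v u).
    by case: (leP a u) => ?; case: (leP a v) => ? ? ?;
      rewrite ler_norml; apply/andP; split; slra.
  have mn (a u v : R) : `|Num.min a u - Num.min a v| <= `|u - v|.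
    have := ler_norm (u - v); have := ler_norm (v - u); rewrite (distrC v u).
    by case: (leP a u) => ?; case: (leP a v) => ? ? ?;
      rewrite ler_norml; apply/andP; split; slra.
  exact: le_trans (mx _ _ _) (mn _ _ _).
Qed.

End lipschitz.

Lemma bounded_lipschitz_vel {V : normedModType R} (T X Y : V -> R) k :
  lipschitz_fun T -> lipschitz_fun X -> lipschitz_fun Y ->
  bounded_lipschitz (fun p => vel k (T p) (X p) (Y p)).
Proof.
move=> hT hX hY.
apply: bounded_lipschitzM; first exact: bounded_lipschitz_dspread.
apply: bounded_lipschitzB; apply: bounded_lipschitzM.
- exact: (bounded_lipschitz_dlin hY).
- apply: bounded_lipschitzM; first exact: bounded_lipschitz_cut.
  exact: bounded_lipschitz_stair.
- exact: bounded_lipschitz_lin.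
- apply: bounded_lipschitzD; apply: bounded_lipschitzM.
  + exact: bounded_lipschitz_dcut.
  + exact: bounded_lipschitz_stair.
  + exact: bounded_lipschitz_cut.
  + exact: bounded_lipschitz_dstair.
Qed.

(** * Superposition of the stages into one field *)

Lemma tim_small t : 0 < t -> exists K, tim K <= t.
Proof.
move=> t0.
have /cvgrPdist_le/(_ _ t0)[N _ H] : (fun n => (l + 2^-1) ^+ n : R) @ \oo --> 0.
  by apply: cvg_expr; rewrite ger0_norm; slra.
exists N; have := H N (leqnn N); rewrite /= sub0r normrN ger0_norm//.
exact: (ltW (tim_gt0 _)).
Qed.

(* A stage number after which every stage is over before time [t]; junk value [0]
   for [t <= 0]. *)
Definition level t : nat := xget 0%N [set K | tim K <= t].

Lemma level_le t : 0 < t -> tim (level t) <= t.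
Proof. by move=> /tim_small; exact: (@xgetPex _ 0%N [set K | tim K <= t]). Qed.

Lemma level0 t : t <= 0 -> level t = 0%N.
Proof.
by move=> t0; apply: xgetPN => K /=; have := tim_gt0 K; move=> *; lra.
Qed.

Lemma stabilized_sum {W : zmodType} (f : nat -> W) t K n :
  (forall k, tim k <= t -> f k = 0) -> tim K <= t -> (K <= n)%N ->
  \sum_(k < n) f k = \sum_(k < K) f k.
Proof.
move=> f0 Kt Kn; rewrite -!(big_mkord xpredT) (big_cat_nat (n := K))//=.
rewrite [X in _ + X]big1_seq ?addr0// => i.
rewrite mem_index_iota => /andP[_ /andP[Ki _]].
by apply/f0/(le_trans _ Kt)/tim_anti.
Qed.

(** The arbitrary choice made by [level] is harmless: every [K] with [tim K <= t] gives the same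
    sum. *)
Lemma level_sum {W : zmodType} (f : nat -> W) t K :
  (forall k, tim k <= t -> f k = 0) -> tim K <= t ->
  \sum_(k < level t) f k = \sum_(k < K) f k.
Proof.
move=> f0 Kt; have t0 : 0 < t := lt_le_trans (tim_gt0 K) Kt.
have [h|/ltnW h] := leqP K (level t); first exact: stabilized_sum f0 Kt h.
by symmetry; exact: stabilized_sum f0 (level_le t0) h.
Qed.

Definition pvel K t x y : R := \sum_(k < K) vel k t x y.
Definition tvel t x y : R := pvel (level t) t x y.
Definition field (p : R * (R * R)) : R * R :=
  (tvel p.1 p.2.1 p.2.2, tvel p.1 p.2.2 p.2.1).

Lemma tvelE K t x y : tim K <= t -> tvel t x y = pvel K t x y.
Proof.
move=> Kt; apply: (@level_sum _ (fun k => vel k t x y)) => // k kt.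
by rewrite /vel dspread_eq0 ?mul0r//; right.
Qed.

Lemma tvel_le0 t x y : t <= 0 -> tvel t x y = 0.
Proof. by move=> /level0; rewrite /tvel => ->; rewrite /pvel big_ord0. Qed.

Lemma pvel_early K t x y : t <= tim K -> pvel K t x y = 0.
Proof.
move=> tK; rewrite /pvel big1// => k _.
rewrite /vel dspread_eq0 ?mul0r//; left; apply: le_trans tK _.
exact: tim_anti.
Qed.

Lemma vel_late k K t x y : t <= tim K -> vel k t x y != 0 -> (K <= k)%N.
Proof.
move=> tK; have [d0|/dspread_neq0/andP[kt _] _] := eqVneq (dspread k t) 0.
  by rewrite /vel d0 mul0r eqxx.
rewrite leqNgt; apply/negP => /tim_anti h.
by have := lt_le_trans kt (le_trans tK h); rewrite ltxx.
Qed.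

(** Before time [tim K] the only stage that can be active has index at least [K]; the bound is
    therefore uniform in the number [n] of stages. *)
Lemma pvel_bound n K t x y : t <= tim K -> `|pvel n t x y| <= cvel * crate ^+ K.
Proof.
move=> tK; have r0 := ltW crate_gt0.
apply: (@sum_at_most_one _ _ (fun k => vel k t x y)) => [|i|i j].
- by rewrite mulr_ge0 ?cvel_ge0// exprn_ge0.
- have [->|/(vel_late tK) Ki] := eqVneq (vel i t x y) 0.
    by rewrite normr0 mulr_ge0 ?cvel_ge0// exprn_ge0.
  apply: le_trans (vel_bound _ _ _ _) _; rewrite ler_wpM2l ?cvel_ge0//.
  by rewrite ler_wiXn2l// ltW// crate_lt1.
- have vd k : vel k t x y != 0 -> dspread k t != 0.
    by apply: contraNN => /eqP d; rewrite /vel d mul0r.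
  by move=> /vd a /vd b; exact: dspread_inj a b.
Qed.

(** Uniform approximation of the field by finitely many stages, each of which is Lipschitz. *)
Lemma tvel_approx K t x y : `|tvel t x y - pvel K t x y| <= cvel * crate ^+ K.
Proof.
have [Kt|/ltW tK] := leP (tim K) t.
  rewrite (tvelE _ _ Kt) subrr normr0 mulr_ge0 ?cvel_ge0// exprn_ge0//.
  exact/ltW/crate_gt0.
by rewrite (pvel_early _ _ tK) subr0 pvel_bound.
Qed.

(** The stages from [K] on are supported within distance [4 * scl K] of the origin in each
    coordinate. *)
Lemma tvel_far K t x y : 4 * scl K <= `|x| \/ 4 * scl K <= `|y| ->
  tvel t x y = pvel K t x y.
Proof.
move=> h; have [Kt|/ltW tK] := leP (tim K) t; first exact: tvelE.
rewrite (pvel_early _ _ tK) /tvel /pvel big1// => k _.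
apply/eqP/negPn/negP => h2; have Kk := vel_late tK h2.
have out z : 4 * scl K <= `|z| -> outside k z.
  move=> hz; have sK := scl_anti Kk; have s0 := scl_gt0 k.
  case: (leP 0 z) hz => z0 hz.
    by rewrite ger0_norm// in hz; right; slra.
  by rewrite ltr0_norm// in hz; left; slra.
move/negP: h2; apply; apply/eqP/vel_out.
by case: h => /out; [left|right].
Qed.

Let r0 : 0 <= crate. Proof. exact/ltW/crate_gt0. Qed.

Lemma crate_small e : 0 < e -> exists K, cvel * crate ^+ K <= e.
Proof.
move=> e0; have c0 := cvel_ge0.
have e1 : 0 < e / (cvel + 1) by rewrite divr_gt0// ltr_wpDl.
have /cvgrPdist_le/(_ _ e1)[N _ H] : (fun n => crate ^+ n : R) @ \oo --> 0.
  by apply: cvg_expr; rewrite ger0_norm// crate_lt1.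
exists N; have := H N (leqnn N); rewrite /= sub0r normrN ger0_norm ?exprn_ge0//.
rewrite ler_pdivlMr ?ltr_wpDl// => /(le_trans _); apply.
by rewrite mulrC ler_wpM2l ?exprn_ge0// lerDl.
Qed.

Lemma scl_small e : 0 < e -> exists K, 4 * scl K <= e.
Proof.
move=> e0.
have e1 : 0 < e / 4 by rewrite divr_gt0.
have /cvgrPdist_le/(_ _ e1)[N _ H] : (fun n => (2 * l) ^+ n : R) @ \oo --> 0.
  by apply: cvg_expr; rewrite ger0_norm ?mulr_ge0 ?(ltW l0)//; slra.
exists N; have := H N (leqnn N); rewrite /= sub0r normrN ger0_norm ?(ltW (scl_gt0 _))//.
by rewrite ler_pdivlMr// mulrC.
Qed.

Lemma normr_fst {V W : normedModType R} (p : V * W) : `|p.1| <= `|p|.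
Proof. by rewrite prod_normE le_max lexx. Qed.

Lemma normr_snd {V W : normedModType R} (p : V * W) : `|p.2| <= `|p|.
Proof. by rewrite prod_normE le_max lexx orbT. Qed.

Lemma bounded_lipschitz_pvel K (b : bool) : exists B, forall p q : R * (R * R),
  `|pvel K p.1 (if b then p.2.1 else p.2.2) (if b then p.2.2 else p.2.1) -
    pvel K q.1 (if b then q.2.1 else q.2.2) (if b then q.2.2 else q.2.1)| <= B * `|p - q|.
Proof.
have hT : lipschitz_fun (fun p : R * (R * R) => p.1).
  by exists 1 => p q; rewrite mul1r; exact: (normr_fst (p - q)).
have hX : lipschitz_fun (fun p : R * (R * R) => p.2.1).
  exists 1 => p q; rewrite mul1r; apply: le_trans (normr_snd (p - q)).
  exact: (normr_fst (p.2 - q.2)).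
have hY : lipschitz_fun (fun p : R * (R * R) => p.2.2).
  exists 1 => p q; rewrite mul1r; apply: le_trans (normr_snd (p - q)).
  exact: (normr_snd (p.2 - q.2)).
rewrite /pvel; case: b.
  have := @bounded_lipschitz_sum _ _ K (fun k p => vel k p.1 p.2.1 p.2.2)
    (fun k => bounded_lipschitz_vel k hT hX hY).
  by move=> [B [_ H]]; exists B.
have := @bounded_lipschitz_sum _ _ K (fun k p => vel k p.1 p.2.2 p.2.1)
    (fun k => bounded_lipschitz_vel k hT hY hX).
by move=> [B [_ H]]; exists B.
Qed.

Lemma pfield_lipschitz K : exists2 B, 0 < B & forall p q : R * (R * R),
  `|pvel K p.1 p.2.1 p.2.2 - pvel K q.1 q.2.1 q.2.2| <= B * `|p - q| /\
  `|pvel K p.1 p.2.2 p.2.1 - pvel K q.1 q.2.2 q.2.1| <= B * `|p - q|.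
Proof.
have [B1 h1] := bounded_lipschitz_pvel K true.
have [B2 h2] := bounded_lipschitz_pvel K false.
exists (`|B1| + `|B2| + 1) => [|p q]; first by rewrite ltr_wpDl.
split; [apply: le_trans (h1 p q) _|apply: le_trans (h2 p q) _]; rewrite ler_wpM2r//.
  by rewrite -addrA (le_trans (ler_norm B1))// lerDl addr_ge0.
by rewrite addrAC (le_trans (ler_norm B2))// lerDr addr_ge0.
Qed.

Lemma field_uniformly_continuous e : 0 < e -> exists2 d, 0 < d &
  forall p q, `|p - q| < d -> `|field p - field q| < e.
Proof.
move=> e0; have e4 : 0 < e / 4 by rewrite divr_gt0.
have [K hK] := crate_small e4.
have [B B0 hB] := pfield_lipschitz K.
exists (e / 4 / B) => [|p q]; first by rewrite divr_gt0.
rewrite ltr_pdivlMr// mulrC => pq.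
have [h1 h2] := hB p q.
have a1 := tvel_approx K p.1 p.2.1 p.2.2.
have a2 := tvel_approx K q.1 q.2.1 q.2.2.
have a3 := tvel_approx K p.1 p.2.2 p.2.1.
have a4 := tvel_approx K q.1 q.2.2 q.2.1.
have T (a b A C : R) : `|A - a| <= e / 4 -> `|C - b| <= e / 4 -> `|a - b| < e / 4 ->
    `|A - C| < e.
  rewrite !ler_norml !ltr_norml => /andP[? ?] /andP[? ?] /andP[? ?].
  by apply/andP; split; slra.
rewrite prod_normE/= gt_max; apply/andP; split; rewrite /field/=.
  exact: T (le_trans a1 hK) (le_trans a2 hK) (le_lt_trans h1 pq).
exact: T (le_trans a3 hK) (le_trans a4 hK) (le_lt_trans h2 pq).
Qed.

Lemma continuous_field : continuous field.
Proof.
move=> p; apply/cvgrPdist_lt => e e0.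
have [d d0 H] := field_uniformly_continuous e0.
have Hn : nbhs (p : R * (R * R)) (ball (p : R * (R * R)) d) by exact: nbhsx_ballx.
by apply: filterS Hn => z; rewrite -ball_normE/=; exact: H.
Qed.

Lemma field_compact_support : exists K : set (R * (R * R)), compact K /\
  forall p, ~ K p -> field p = 0.
Proof.
exists (`[0, 1]%classic `*` (`[-4, 4]%classic `*` `[-4, 4]%classic)); split.
  by apply: compact_setX; [|apply: compact_setX]; exact: segment_compact.
move=> [t [x y]] nK; rewrite /field/=.
have [t0|t0] := leP t 0; first by rewrite !tvel_le0.
have [t1|t1] := leP 1 t.
  (* Stage 0 ends at time [tim 0 = 1], after which the field is an empty sum. *)
  by rewrite !(@tvelE 0) /tim ?expr0// /pvel !big_ord0.
have far : 4 * scl 0 <= `|x| \/ 4 * scl 0 <= `|y|.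
  rewrite /scl expr0 mulr1; apply: contrapT => /not_orP[/negP + /negP].
  rewrite -!ltNge => x4 y4; apply: nK; split; [|split] => /=.
  - by rewrite in_itv/= (ltW t0) (ltW t1).
  - by rewrite in_itv/= -ler_norml ltW.
  - by rewrite in_itv/= -ler_norml ltW.
rewrite !(@tvel_far 0) /pvel ?big_ord0//.
by case: far; [right|left].
Qed.

(** Near a point with positive time or nonzero position, time or distance to the origin is bounded
    below, so a fixed number [K] of stages describes the field. *)
Lemma field_locally_lipschitz (D : set (R * (R * R))) :
  (forall p, D p -> 0 < p.1 \/ p.2 != 0) -> loc_lipschitz_on D field.
Proof.
move=> hD p /hD Dp.
suff [r rp [K hK]] : exists2 r, 0 < r & exists K, forall q, ball p r q ->
    tim K <= q.1 \/ (4 * scl K <= `|q.2.1| \/ 4 * scl K <= `|q.2.2|).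
  have [B B0 hB] := pfield_lipschitz K.
  exists r => //; exists B => q q' _ _ /hK Bq /hK Bq'.
  have E z : (tim K <= z.1 \/ (4 * scl K <= `|z.2.1| \/ 4 * scl K <= `|z.2.2|)) ->
      field z = (pvel K z.1 z.2.1 z.2.2, pvel K z.1 z.2.2 z.2.1).
    rewrite /field; case => h; first by rewrite !(tvelE _ _ h).
    by rewrite !(tvel_far z.1 (K := K))//; case: h; [right|left].
  rewrite (E _ Bq) (E _ Bq') prod_normE/= ge_max.
  by have [-> ->] := hB q q'.
case: Dp => [t0|x0].
  have t2 : 0 < p.1 / 2 by rewrite divr_gt0.
  have [K hK] := tim_small t2.
  exists (p.1 / 2) => //; exists K => q; rewrite -ball_normE/= => pq; left.
  have := le_lt_trans (normr_fst (p - q)) pq; rewrite /= ltr_norml => /andP[_ ?].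
  by slra.
have x2 : 0 < `|p.2| / 2 by rewrite divr_gt0// normr_gt0.
have [K hK] := scl_small x2.
exists (`|p.2| / 2) => //; exists K => q; rewrite -ball_normE/= => pq; right.
have pq2 := le_lt_trans (normr_snd (p - q)) pq.
have : `|p.2| / 2 <= `|q.2|.
  have := ler_normB (p.2 - q.2) (- q.2); rewrite opprK subrK normrN.
  by move: pq2 => /= ? ?; slra.
rewrite [X in _ <= X]prod_normE le_max => /orP[] h; [left|right]; exact: le_trans h.
Qed.

(** * Motion of the dust and its agreement with the field *)

(* [weight j t] is [(2 ^+ j)^-1 * min ((2 * l) ^+ j) theta] where [theta] is the
   [spread] at time [t]: the dust at time [t] is the closure of the finite sums of
   [weight j t * e j] in each coordinate. *)
Definition pweight K j t : R := l ^+ j - (2 ^+ j)^-1 *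
  \sum_(k < K) (if (j <= k)%N then dscl k * (1 - ramp k t) else 0).
Definition weight j t : R := if t <= 0 then 0 else pweight (level t) j t.
Definition position (e : nat -> bool) n t : R := \sum_(j < n) weight j t * (e j)%:R.

Lemma weightE K j t : tim K <= t -> weight j t = pweight K j t.
Proof.
move=> Kt; have t0 : 0 < t := lt_le_trans (tim_gt0 K) Kt.
rewrite /weight leNgt t0/= /pweight.
rewrite (@level_sum _ (fun k => if (j <= k)%N then dscl k * (1 - ramp k t) else 0) _ K)//.
by move=> k kt; rewrite ramp_hi// subrr mulr0; case: ifP.
Qed.

Lemma is_derive_pweight K j t : is_derive t 1 (pweight K j)
  ((2 ^+ j)^-1 * \sum_(k < K) (if (j <= k)%N then dspread k t else 0)).
Proof.
have h (k : 'I_K) : is_derive t 1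
    (fun s => if (j <= k)%N then dscl k * (1 - ramp k s) else 0)
    (if (j <= k)%N then - dspread k t else 0).
  case: ifP => _; last exact: is_derive_cst.
  have := @is_deriveZ _ _ _ _ (dscl k) t 1 _
    (@is_deriveB _ _ _ _ _ t 1 _ _ (is_derive_cst (1 : R) t 1) (is_derive_ramp k t)).
  move=> H; apply: (is_derive_eq H).
  by rewrite sub0r /GRing.scale/= mulrN.
have := @is_derive_sum _ _ _ _ _ _ _ _ h.
move=> /(@is_deriveZ _ _ _ _ ((2 ^+ j)^-1) _ _ _).
move=> /(@is_deriveB _ _ _ _ _ t 1 _ _ (is_derive_cst (l ^+ j) t 1)).
set F := (X in is_derive _ _ X _).
have -> : F = pweight K j.
  by apply/funext => z; rewrite /F/= /pweight /GRing.scale/= !fctE fct_sumE.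
move=> H; apply: (is_derive_eq H); rewrite sub0r -scalerN -sumrN.
by congr (_ * _); apply: eq_bigr => k _; case: ifP; rewrite ?opprK ?oppr0.
Qed.

(** The inequality is strict so that [weight j] agrees with [pweight K j] on a neighbourhood of
    [t]. *)
Lemma is_derive_weight K j t : tim K < t -> is_derive t 1 (weight j)
  ((2 ^+ j)^-1 * \sum_(k < K) (if (j <= k)%N then dspread k t else 0)).
Proof.
move=> Kt; apply: near_eq_is_derive (is_derive_pweight K j t) => //.
near=> s; symmetry; apply: weightE; apply: ltW; near: s.
exact: lt_nbhsr.
Unshelve. all: by end_near. Qed.

Lemma sum_dscl j k : (j <= k)%N ->
  \sum_(i < k) (if (j <= i)%N then dscl i else 0) = scl j - scl k.
Proof.
move=> /subnK <-; elim: (k - j)%N => [|n IH].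
  rewrite add0n subrr big1// => i _; by rewrite leqNgt ltn_ord.
by rewrite addSn big_ord_recr/= IH leq_addl /dscl; ring.
Qed.

(** Going backwards, stages before [k] are complete and their contributions telescope. The digits up
    to [k] thus select a point of the grid of step [cell k t], and the later ones are still at
    rest. *)
Lemma weight_on k j t : tim k.+1 <= t -> t <= tim k ->
  weight j t = if (j <= k)%N then 2 ^+ (k - j) * cell k t else l ^+ j.
Proof.
move=> kt tk; rewrite (weightE j kt) /pweight big_ord_recr/=.
rewrite (eq_bigr (fun i : 'I_k => if (j <= i)%N then dscl i else 0)); last first.
  move=> i _; rewrite ramp_lo ?subr0 ?mulr1//.
  exact: le_trans tk (tim_anti _).
case: ifPn => jk; last first.
  rewrite big1 ?addr0 ?mulr0 ?subr0// => i _.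
  by case: ifPn => // ji; rewrite (leq_trans ji (ltnW (ltn_ord i))) in jk.
rewrite sum_dscl//.
have -> : 2 ^+ (k - j) * cell k t = (2 ^+ j)^-1 * spread k t.
  rewrite /cell -[in (2 ^+ k)^-1](subnK jk) exprD; field.
  by rewrite !lt0r_neq0 ?exprn_gt0.
have -> : l ^+ j = (2 ^+ j)^-1 * scl j.
  by rewrite /scl exprMn mulKf// lt0r_neq0// exprn_gt0.
by rewrite /spread /dscl; ring.
Qed.

Lemma time_cases t : 0 < t -> tim 0 < t \/ exists k, tim k.+1 < t /\ t <= tim k.
Proof.
move=> t0; have [K hK] := tim_small (divr_gt0 t0 (ltr0n R 2)).
have ex : exists K, tim K < t by exists K; slra.
have [[|k] Kt Kmin] := ex_minnP ex; first by left.
right; exists k; split => //; rewrite leNgt; apply/negP => /Kmin.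
by rewrite ltnn.
Qed.

Lemma weight_le0 j t : t <= 0 -> weight j t = 0.
Proof. by rewrite /weight => ->. Qed.

Lemma geometric_le m n : \sum_(m <= j < n) l ^+ j <= l ^+ m / (1 - l).
Proof.
have [nm|/ltnW mn] := leqP n m.
  by rewrite big_geq// divr_ge0 ?exprn_ge0// ltW.
rewrite ler_pdivlMr// -(subnK mn).
suff -> : (\sum_(m <= j < (n - m) + m) l ^+ j) * (1 - l) = l ^+ m - l ^+ (n - m + m).
  by rewrite gerBl exprn_ge0// ltW.
elim: (n - m)%N => [|i IH]; first by rewrite add0n big_geq// mul0r subrr.
by rewrite addSn big_nat_recr ?leq_addl//= mulrDl IH exprS; ring.
Qed.

Lemma weight_ge0 j t : 0 <= weight j t.
Proof.
have [/weight_le0 ->//|/time_cases[|[k [kt tk]]]] := leP t 0.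
  by move=> /ltW/weightE ->; rewrite /pweight big_ord0 mulr0 subr0 exprn_ge0// ltW.
rewrite (weight_on _ (ltW kt) tk); case: ifP => _; last by rewrite exprn_ge0// ltW.
by rewrite mulr_ge0 ?exprn_ge0// ltW// cell_gt0.
Qed.

Lemma weight_small K j t : t <= tim K -> weight j t <= scl K.
Proof.
move=> tK; have sK := scl_gt0 K.
have lj i : l ^+ i <= scl i by rewrite /scl exprMn ler_peMl ?exprn_ge0 ?exprn_ege1 ?ltW ?ler1n ?ltr1n.
have [/weight_le0 ->|t0] := leP t 0; first exact: ltW.
have [h|[k [kt tk]]] := time_cases t0.
  by have := lt_le_trans h (le_trans tK (tim_anti (leq0n K))); rewrite ltxx.
have Kk : (K <= k)%N.
  rewrite leqNgt; apply/negP => /tim_anti h.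
  by have := lt_le_trans kt (le_trans tK h); rewrite ltxx.
have skK := scl_anti Kk.
rewrite (weight_on j (ltW kt) tk); case: ifPn => jk.
  apply: le_trans skK; apply: le_trans (spread_le k t).
  rewrite /cell mulrA ler_piMl//.
    exact: le_trans (ltW (scl_gt0 _)) (spread_ge _ _).
  by rewrite ler_pdivrMr ?exprn_gt0// mul1r ler_weXn2l ?ler1n// leq_subr.
apply: le_trans (lj j) _; apply: le_trans skK; apply: scl_anti.
by rewrite ltnW// ltnNge.
Qed.

Lemma weight_le j t : weight j t <= l ^+ j.
Proof.
have [/weight_le0 ->|t0] := leP t 0; first by rewrite exprn_ge0// ltW.
have /weightE -> := level_le t0.
rewrite /pweight gerBl mulr_ge0 ?invr_ge0 ?exprn_ge0//.
apply: sumr_ge0 => k _; case: ifP => // _.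
by rewrite mulr_ge0 ?(ltW (dscl_gt0 _))// subr_ge0; case/andP: (ramp_ge0_le1 k t).
Qed.

Lemma continuous_weight j : continuous (weight j).
Proof.
move=> t; have [t0|t0] := leP t 0.
  apply/cvgrPdist_le => e e0; have [K hK] := scl_small e0.
  near=> s; rewrite (weight_le0 j t0) sub0r normrN ger0_norm ?weight_ge0//.
  have sK : scl K <= 4 * scl K by have := scl_gt0 K; slra.
  apply: le_trans (le_trans sK hK).
  apply: weight_small; apply: ltW; near: s.
  by apply: lt_nbhsl; exact: le_lt_trans t0 (tim_gt0 K).
have [K hK] := tim_small (divr_gt0 t0 (ltr0n R 2)).
have Kt : tim K < t by slra.
by apply: differentiable_continuous; apply/derivable1_diffP; case: (is_derive_weight j Kt).
Unshelve. all: by end_near. Qed.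

Lemma continuous_position e n : continuous (position e n).
Proof.
move=> t; rewrite /position; elim: n => [|n IH].
  rewrite (_ : (fun _ => _) = cst 0); first exact: cvg_cst.
  by apply/funext => s; rewrite big_ord0.
rewrite (_ : (fun _ => _) = fun t =>
    \sum_(j < n) weight j t * (e j)%:R + weight n t * (e n)%:R).
  apply: cvgD IH _; apply: cvgM; first exact: continuous_weight.
  exact: cvg_cst.
by apply/funext => s; rewrite big_ord_recr.
Qed.

Lemma position_le0 e n t : t <= 0 -> position e n t = 0.
Proof. by move=> t0; rewrite /position big1// => j _; rewrite weight_le0 ?mul0r. Qed.

Lemma position_ge0 e n t : 0 <= position e n t.
Proof. by apply: sumr_ge0 => j _; rewrite mulr_ge0 ?weight_ge0. Qed.

Lemma position_le2 e n t : position e n t <= 2.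
Proof.
apply: (@le_trans _ _ (\sum_(0 <= j < n) l ^+ j)).
  rewrite big_mkord; apply: ler_sum => j _.
  rewrite -[leRHS]mulr1 ler_pM ?weight_ge0 ?weight_le//.
  by case: (e j).
apply: le_trans (geometric_le 0 n) _.
by rewrite expr0 ler_pdivrMr//; slra.
Qed.

(* The number of the grid cell of stage [k] containing [position e n t]. *)
Definition head_index (e : nat -> bool) n k : nat :=
  \sum_(j < n) (if (j <= k)%N then 2 ^ (k - j) * e j else 0)%N.

Lemma head_index_lt e n k : (head_index e n k < 2 ^ k.+1)%N.
Proof.
(* Strengthened for the induction: the extra power of 2 is the room left for the digits still to
   come. *)
suff H : (head_index e n k + 2 ^ (k.+1 - minn n k.+1) <= 2 ^ k.+1)%N.
  by apply: leq_trans H; rewrite -addn1 leq_add2l expn_gt0.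
rewrite /head_index; elim: n => [|n IH]; first by rewrite big_ord0 min0n subn0.
rewrite big_ord_recr/=; case: (leqP n k) => nk; last first.
  have -> : minn n.+1 k.+1 = minn n k.+1 by lia.
  by rewrite addn0.
move: IH; have -> : minn n.+1 k.+1 = n.+1 by lia.
have -> : minn n k.+1 = n by lia.
rewrite subSS; have -> : (k.+1 - n = (k - n).+1)%N by lia.
rewrite [X in (_ + X)%N](expnS 2).
move: (\sum_(j < n) _)%N (2 ^ (k - n))%N (2 ^ k.+1)%N => S A B.
by case: (e n) => /= ?; rewrite ?muln1 ?muln0; lia.
Qed.

(** The digits after [k] contribute at most [l ^+ k.+1 / (1 - l)]; [wid k] is exactly what is
    missing to reach [2 * l ^+ k.+1], the lower bound of [cell k t]. *)
Lemma position_on e n k t : tim k.+1 <= t -> t <= tim k ->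
  exists2 r, 0 <= r /\ r + wid k <= cell k t &
    position e n t = (head_index e n k)%:R * cell k t + r.
Proof.
move=> kt tk.
exists (\sum_(j < n) (if (j <= k)%N then 0 else l ^+ j * (e j)%:R)).
  split.
    by apply: sumr_ge0 => j _; case: ifP => // _; rewrite mulr_ge0 ?exprn_ge0// ltW.
  apply: le_trans (cell_ge k t).
  have -> : 2 * l ^+ k.+1 = l ^+ k.+1 / (1 - l) + wid k.
    by rewrite /wid; field; slra.
  rewrite lerD2r; apply: le_trans (geometric_le k.+1 (n + k.+1)%N).
  rewrite -(big_mkord xpredT (fun j => if (j <= k)%N then 0 else l ^+ j * (e j)%:R)).
  apply: (@le_trans _ _
      (* The range is lengthened so that it can be split at [k.+1] even when [n] is smaller. *)
      (\sum_(0 <= j < n + k.+1) (if (j <= k)%N then 0 else l ^+ j))).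
    rewrite [leRHS](big_cat_nat (n := n)) ?leq_addr//=.
    apply: ler_wpDr.
      by apply: sumr_ge0 => j _; case: ifP => // _; rewrite exprn_ge0// ltW.
    apply: ler_sum => j _; case: ifP => // _.
    by rewrite ler_piMr ?exprn_ge0 ?(ltW l0)//; case: (e j).
  rewrite (big_cat_nat (n := k.+1)) ?leq_addl//=.
  rewrite big_mkord big1 ?add0r; last by move=> j _; rewrite -ltnS ltn_ord.
  rewrite le_eqVlt; apply/orP; left; apply/eqP.
  by apply: eq_big_nat => j /andP[kj _]; rewrite leqNgt kj.
rewrite /head_index natr_sum mulr_suml -big_split/=.
apply: eq_bigr => j _; rewrite (weight_on j kt tk).
case: ifP => _; last by rewrite mul0r add0r.
by rewrite addr0 natrM natrX; ring.
Qed.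

(** Both sides are sums over stages and are compared stage by stage. In the active one, both
    coordinates lie on plateaus, where the velocity is [dspread k t] times
    [head_index e n k / 2 ^+ k]: the derivative of the moving digits. *)
Lemma position_ode (e e' : nat -> bool) n t : 0 < t ->
  is_derive t 1 (position e n) (tvel t (position e n t) (position e' n t)).
Proof.
move=> t0; have [K hK] := tim_small (divr_gt0 t0 (ltr0n R 2)).
have Kt : tim K < t by slra.
have h (j : 'I_n) : is_derive t 1 (fun s => weight j s * (e j)%:R)
    ((2 ^+ j)^-1 * (\sum_(k < K) (if (j <= k)%N then dspread k t else 0)) * (e j)%:R).
  have := @is_deriveM _ _ (weight j) (cst (e j)%:R) t 1 _ _
    (is_derive_weight j Kt) (is_derive_cst _ t 1).
  by move=> H; apply: (is_derive_eq H); rewrite scaler0 add0r /GRing.scale/= mulrC.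
have := @is_derive_sum _ _ _ _ _ _ _ _ h.
set F := (X in is_derive _ _ X _).
have -> : F = position e n by apply/funext => z; rewrite /F fct_sumE.
move=> H; apply: (is_derive_eq H).
rewrite (tvelE _ _ (ltW Kt)) /pvel.
under eq_bigr do rewrite mulr_sumr mulr_suml.
rewrite exchange_big/=; apply: eq_bigr => k _.
have [d0|dn0] := eqVneq (dspread k t) 0.
  rewrite /vel d0 mul0r big1// => j _.
  by case: ifP; rewrite ?mulr0 ?mul0r.
have /andP[kt tk] := dspread_neq0 dn0.
have [r [rr0 rw] ->] := position_on e n (ltW kt) (ltW tk).
have [r' [rr0' rw'] ->] := position_on e' n (ltW kt) (ltW tk).
rewrite vel_plateau ?head_index_lt//.
rewrite /head_index natr_sum mulr_suml mulr_sumr; apply: eq_bigr => j _.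
case: ifP => jk; last by rewrite mulr0 !mul0r mulr0.
have -> : 2 ^+ k = 2 ^+ (k - j) * 2 ^+ j :> R by rewrite -exprD subnK.
rewrite natrM natrX; field.
by rewrite !lt0r_neq0 ?exprn_gt0.
Qed.

(* Quantitative separation: two digit sequences that first differ at place [n]
   give points at distance at least [G * l ^+ n]. *)
Lemma weight_gap t : 0 < t -> exists2 G, 0 < G &
  forall n J, \sum_(n.+1 <= j < J) weight j t <= weight n t - G * l ^+ n.
Proof.
move=> t0; have Kt := level_le t0; set K := level t in Kt.
have late j : (K <= j)%N -> weight j t = l ^+ j.
  move=> Kj; rewrite (weightE j Kt) /pweight big1 ?mulr0 ?subr0// => k _.
  by rewrite leqNgt (leq_trans (ltn_ord k) Kj).
(* The sums for [j] and [j.+1] differ only in the term of stage [j], which is at most [dscl j]. *)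
have half j : 2 * weight j.+1 t <= weight j t.
  rewrite !(weightE _ Kt) /pweight.
  set S1 := \sum_(k < K) _; set S2 := \sum_(k < K) _.
  have sE i : l ^+ i = (2 ^+ i)^-1 * scl i.
    by rewrite /scl exprMn mulKf// lt0r_neq0// exprn_gt0.
  rewrite !sE -!mulrBr mulrA exprS invfM mulVKf// ler_wpM2l ?invr_ge0 ?exprn_ge0//.
  suff : S2 - S1 <= dscl j by rewrite /dscl => ?; slra.
  rewrite /S1 /S2 -sumrB.
  case: (ltnP j K) => jK; last first.
    rewrite big1 ?(ltW (dscl_gt0 j))// => k _.
    have kj : (k < j)%N := leq_trans (ltn_ord k) jK.
    by rewrite leqNgt kj/= leqNgt ltnS ltnW//= subrr.
  rewrite (bigD1 (Ordinal jK))//= leqnn ltnn subr0 big1 ?addr0.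
    rewrite ler_piMr ?(ltW (dscl_gt0 j))//.
    by case/andP: (ramp_ge0_le1 j t) => *; slra.
  move=> k kj; have -> : (j < k)%N = (j <= k)%N.
    rewrite ltn_neqAle; case: eqP => // jk; exfalso; move/negP: kj; apply.
    by apply/eqP/val_inj.
  by rewrite subrr.
have g0 : 0 < (1 - 2 * l) / (1 - l) by rewrite divr_gt0.
(* The gap at generation [K], from which the weights are exactly geometric. Earlier generations
   inherit it by descending induction, using [half]. *)
pose G := l ^+ K * ((1 - 2 * l) / (1 - l)).
have G0 : 0 < G by rewrite mulr_gt0// exprn_gt0.
have low n J : (K <= n)%N ->
    \sum_(n.+1 <= j < J) weight j t <= weight n t - l ^+ n * ((1 - 2 * l) / (1 - l)).
  move=> Kn; rewrite (late n Kn).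
  have -> : l ^+ n - l ^+ n * ((1 - 2 * l) / (1 - l)) = l ^+ n.+1 / (1 - l).
    by rewrite exprS; field; slra.
  apply: le_trans (geometric_le n.+1 J); rewrite le_eqVlt; apply/orP; left; apply/eqP.
  by apply: eq_big_nat => j /andP[nj _]; apply: late; rewrite (leq_trans Kn)// ltnW.
have high d n J : (n + d = K)%N -> \sum_(n.+1 <= j < J) weight j t <= weight n t - G.
  elim: d n => [|d IH] n; first by rewrite addn0 => nK; rewrite /G -nK low// nK.
  rewrite addnS -addSn => /IH h.
  have := half n; have := weight_ge0 n.+1 t.
  case: (ltnP n.+1 J) => nJ; first by rewrite big_ltn//; move: h => *; slra.
  move: h; rewrite !big_geq//; first by move=> *; slra.
  exact: leq_trans nJ _.
exists G => // n J; case: (leqP K n) => Kn.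
  apply: le_trans (low n J Kn) _; rewrite lerD2l lerN2 mulrC ler_wpM2l ?exprn_ge0 ?(ltW l0)//.
  by rewrite /G ler_piMl ?(ltW g0)// exprn_ile1 ?(ltW l0)//; slra.
apply: le_trans (high (K - n)%N n J _) _; first by rewrite subnKC// ltnW.
rewrite lerD2l lerN2 ler_piMr ?(ltW G0)// exprn_ile1 ?(ltW l0)//; slra.
Qed.

End velocity.

(** * Borel sets and integrable functions of the plane *)

Section plane_measurability.
Context {R : realType}.

(** Measurability refers to the product sigma-algebra; an open set is the countable union of the
    squares it contains with rational centre and radius [n.+1%:R^-1]. *)
Lemma open_plane_measurable (U : set (R * R)) : open U -> measurable U.
Proof.
move=> oU.
pose B (a b : rat) (n : nat) : set (R * R) :=
  ball (ratr a : R) (n.+1%:R^-1) `*` ball (ratr b : R) (n.+1%:R^-1).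
pose C a b n := if `[< B a b n `<=` U >] then B a b n else set0.
have -> : U = \bigcup_a \bigcup_b \bigcup_n C a b n.
  apply/seteqP; split => [[x y] Uxy|p [a _ [b _ [n _]]]]; last first.
    by rewrite /C; case: asboolP => // + Bp; exact.
  have : nbhs ((x, y) : R * R) U by exact: open_nbhs_nbhs.
  move=> /nbhs_ballP[r /= r0 xyU].
  have [n nr] : exists n, n.+1%:R^-1 < r / 2 :> R.
    have r2 : 0 < r / 2 by rewrite divr_gt0.
    by have [n _ H] := near_infty_natSinv_lt (PosNum r2); exists n; exact: (H n (leqnn n)).
  have n0 : 0 < n.+1%:R^-1 :> R by rewrite invr_gt0.
  have apx (d z : R) : 0 < d -> exists q : rat, ball (ratr q : R) d z.
    move=> d0; have [|q] := @rat_in_itvoo R (z - d) (z + d); first lra.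
    rewrite in_itv/= => /andP[q1 q2]; exists q.
    by rewrite -ball_normE/= ltr_norml; apply/andP; split; lra.
  have [a ax] := apx _ x n0; have [b by_] := apx _ y n0.
  exists a => //; exists b => //; exists n => //; rewrite /C.
  case: asboolP => [_|]; first by split.
  move=> []; move=> [x' y'] [/= ax' by']; apply: xyU.
  have tri (d z z' c : R) : d < r / 2 -> ball c d z -> ball c d z' -> ball z r z'.
    move=> dr; rewrite -!ball_normE/= !ltr_norml => /andP[? ?] /andP[? ?].
    by apply/andP; split; lra.
  by split; [exact: tri nr ax ax'|exact: tri nr by_ by'].
do 2 (apply: bigcupT_measurable_rat => ?).
apply: bigcupT_measurable => n; rewrite /C; case: asboolP => // _.
by apply: measurableX; apply: open_measurable; apply: ball_open; rewrite invr_gt0.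
Qed.

Lemma continuous_plane_measurable (f : R * R -> R) :
  continuous f -> measurable_fun setT f.
Proof.
move=> /continuousP cf; apply: (measurability _ (measurable_realfun.RGenOpens.measurableE R)).
move=> _ [_ [a [b ->] <-]]; rewrite setTI; apply: open_plane_measurable.
exact/cf/interval_open.
Qed.

Lemma integrable_compact_plane (f : R * R -> R) (M : R) : continuous f ->
  (forall x y, M <= `|x| \/ M <= `|y| -> f (x, y) = 0) ->
  ((@lebesgue_measure R) \x (@lebesgue_measure R))%E.-integrable setT (EFin \o f).
Proof.
move=> cf f0.
pose I : set R := `[- M, M]%classic.
have mI : measurable I by exact: measurable_itv.
have mII : measurable (I `*` I) by exact: measurableX.
have -> : EFin \o f = (EFin \o f) \_ (I `*` I).
  apply/funext => -[x y]; rewrite patchE; case: ifPn => //.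
  rewrite notin_setE => nI; rewrite /= f0//; apply: contrapT => /not_orP[].
  move=> /negP + /negP; rewrite -!ltNge => /ltW h1 /ltW h2; apply: nI.
  by split; rewrite /I/= in_itv/= -ler_norml.
have := @integrable_mkcond _ (measurableTypeR R * measurableTypeR R)%type R
  (@lebesgue_measure R \x @lebesgue_measure R)%E (I `*` I) (EFin \o f) mII.
move=> [+ _]; apply.
apply: measurable_bounded_integrable => //.
- rewrite [X in (X < _)%E](_ : _ = (lebesgue_measure I * lebesgue_measure I)%E).
    by rewrite /I /= lebesgue_measure_itv/=; case: ifP => _; rewrite ?mule0 -?EFinD -?EFinM ltry.
  exact: product_measure1E.
- by apply: measurable_funTS; exact: continuous_plane_measurable.
- have cII : compact (I `*` I : set (R * R)).
    by apply: compact_setX; exact: segment_compact.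
  have := @continuous_compact _ _ f (I `*` I) (continuous_subspaceT cf) cII.
  move=> /compact_bounded[N [_ HN]]; exists N; split; first exact: num_real.
  by move=> r Nr z Iz; apply: (HN r Nr); exists z.
Qed.

End plane_measurability.

(** * Weak divergence of a skew gradient *)

Section integration.
Context {R : realType}.

Lemma integral_derivative_compact (F dF : R -> R) (M : R) :
  (forall x : R, is_derive x 1 F (dF x)) -> continuous dF ->
  (forall x, M <= `|x| -> F x = 0 /\ dF x = 0) ->
  (\int[@lebesgue_measure R]_x (dF x)%:E = 0)%E.
Proof.
move=> dF' cdF F0.
pose N := `|M| + 1.
have MN : M <= N by rewrite (le_trans (ler_norm M))// lerDl.
have N0 : 0 < N by rewrite ltr_wpDl.
have -> : (\int[@lebesgue_measure R]_x (dF x)%:E =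
    \int[@lebesgue_measure R]_(x in `[(- N)%R, N]) (dF x)%:E)%E.
  rewrite [RHS]integral_mkcond; apply: eq_integral => x _.
  rewrite patchE; case: ifPn => //; rewrite notin_setE/= in_itv/= -ler_norml => /negP.
  by rewrite -ltNge => /ltW/(le_trans MN)/F0[_ ->].
rewrite (@continuous_FTC2 _ _ F); last 1 first.
- by move=> x _; rewrite derive1E; exact: derive_val.
- have E1 : F N = 0 by apply: (F0 N _).1; rewrite gtr0_norm.
  have E2 : F (- N) = 0 by apply: (F0 (- N) _).1; rewrite normrN gtr0_norm.
  by rewrite E1 E2 subee.
- by lra.
- exact: continuous_subspaceT.
- have cF := continuous_derive dF'; split.
  + by move=> x _; case: (dF' x).
  + exact/cvg_at_right_filter/cF.
  + exact/cvg_at_left_filter/cF.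
Qed.

Lemma is_derive_line {V : normedModType R} (f : V -> R) (q e : V) (s : R) :
  derivable f (q + s *: e) e ->
  is_derive s 1 (fun r => f (q + r *: e)) ('D_e f (q + s *: e)).
Proof.
move=> /cvg_ex[L fL].
have E : (fun h => h^-1 *: (f (q + (h *: (1 : R) + s) *: e) - f (q + s *: e))) =
    (fun h => h^-1 *: (f (h *: e + (q + s *: e)) - f (q + s *: e))).
  apply/funext => h; congr (_ *: (f _ - _)).
  by rewrite scalerDl [h *: 1]mulr1 addrCA.
have -> : 'D_e f (q + s *: e) = L by exact/cvg_lim.
apply: DeriveDef; first by apply/cvg_ex; exists L; rewrite E.
by apply/cvg_lim => //; rewrite E.
Qed.

Lemma is_derive_fst (f : R * R -> R) (x y : R) : derivable f (x, y) (1, 0) ->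
  is_derive x 1 (fun r => f (r, y)) ('D_(1, 0) f (x, y)).
Proof.
have E r : (0, y) + r *: ((1, 0) : R * R) = (r, y).
  by congr (_, _); rewrite /= ?add0r /GRing.scale/= ?mulr1 ?mulr0 ?addr0.
rewrite -(E x) => /is_derive_line; rewrite E.
by under eq_fun do rewrite E.
Qed.

Lemma is_derive_snd (f : R * R -> R) (x y : R) : derivable f (x, y) (0, 1) ->
  is_derive y 1 (fun r => f (x, r)) ('D_(0, 1) f (x, y)).
Proof.
have E r : (x, 0) + r *: ((0, 1) : R * R) = (x, r).
  by congr (_, _); rewrite /= ?add0r /GRing.scale/= ?mulr1 ?mulr0 ?addr0.
rewrite -(E y) => /is_derive_line; rewrite E.
by under eq_fun do rewrite E.
Qed.

Lemma smooth_derivable {V : normedModType R} (f : V -> R) : smooth f ->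
  forall x v, derivable f x v.
Proof. by move=> [+ _] x v => /(_ [::]). Qed.

#[local] Arguments smooth_derivable {V f} _ x v.

Lemma smooth_continuous_derive {V : normedModType R} (f : V -> R) : smooth f ->
  forall v, continuous ('D_v f).
Proof. by move=> [_ +] v => /(_ [:: v]). Qed.

Lemma smooth_continuous {V : normedModType R} (f : V -> R) :
  smooth f -> continuous f.
Proof. by move=> [_ /(_ [::])]. Qed.

Lemma continuous_pair {U V W : topologicalType} (f : U -> V) (g : U -> W) :
  continuous f -> continuous g -> continuous (fun x => (f x, g x)).
Proof. by move=> cf cg x; apply: cvg_pair; [exact: cf|exact: cg]. Qed.

Section skew_product.
Variables (f df g dg : R -> R) (M : R) (psi : R * R -> R).
Hypotheses (f' : forall x : R, is_derive x 1 f (df x)) (cdf : continuous df)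
  (g' : forall x : R, is_derive x 1 g (dg x)) (cdg : continuous dg)
  (f0 : forall x, M <= `|x| -> f x = 0 /\ df x = 0)
  (g0 : forall x, M <= `|x| -> g x = 0 /\ dg x = 0)
  (spsi : smooth psi).

Let cf : continuous f. Proof. exact: continuous_derive f'. Qed.
Let cg : continuous g. Proof. exact: continuous_derive g'. Qed.
Let cpsi : continuous psi. Proof. exact: smooth_continuous. Qed.
Let cpsi1 : continuous ('D_(1, 0) psi). Proof. exact: smooth_continuous_derive. Qed.
Let cpsi2 : continuous ('D_(0, 1) psi). Proof. exact: smooth_continuous_derive. Qed.
Let c_fst (h : R -> R) : continuous h -> continuous (fun z : R * R => h z.1).
Proof. by move=> ch z; apply: continuous_comp; [exact: cvg_fst|exact: ch]. Qed.
Let c_snd (h : R -> R) : continuous h -> continuous (fun z : R * R => h z.2).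
Proof. by move=> ch z; apply: continuous_comp; [exact: cvg_snd|exact: ch]. Qed.

(** The term [df * dg * psi] is added to both parts of the integrand: it makes [H1] an exact
    derivative in the first variable and [H2] one in the second, and cancels in their difference. *)
Let H1 (z : R * R) : R := (f z.1 * 'D_(1, 0) psi z + df z.1 * psi z) * dg z.2.
Let H2 (z : R * R) : R := (g z.2 * 'D_(0, 1) psi z + dg z.2 * psi z) * df z.1.
Local Notation leb := (@lebesgue_measure R).

Let cH1 : continuous H1.
Proof.
move=> z; apply: cvgM; last exact: c_snd.
by apply: cvgD; apply: cvgM; [exact: c_fst|exact: cpsi1|exact: c_fst|exact: cpsi].
Qed.

Let cH2 : continuous H2.
Proof.
move=> z; apply: cvgM; last exact: c_fst.
by apply: cvgD; apply: cvgM; [exact: c_snd|exact: cpsi2|exact: c_snd|exact: cpsi].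
Qed.

Let iH1 : (leb \x leb)%E.-integrable setT (EFin \o H1).
Proof.
apply: (@integrable_compact_plane _ _ M cH1) => x y.
by rewrite /H1/= => -[/f0[-> ->]|/g0[_ ->]]; ring.
Qed.

Let iH2 : (leb \x leb)%E.-integrable setT (EFin \o H2).
Proof.
apply: (@integrable_compact_plane _ _ M cH2) => x y.
by rewrite /H2/= => -[/f0[_ ->]|/g0[-> ->]]; ring.
Qed.

Let intH1 : (\int[(leb \x leb)%E]_z (H1 z)%:E = 0)%E.
Proof.
have := integral21_prod_meas1 iH1; rewrite /fubini_G/= => <-.
apply: integral0_eq => y _.
apply: (@integral_derivative_compact (fun x => f x * psi (x, y) * dg y) _ M).
- move=> x; have p' := @is_derive_fst psi x y (smooth_derivable spsi _ _).
  have := @is_deriveM _ _ _ _ x 1 _ _ (is_deriveM (f' x) p') (is_derive_cst (dg y) x 1).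
  move=> H; apply: (is_derive_eq H); rewrite /H1/= scaler0 add0r /GRing.scale/=; ring.
- move=> x; apply: (@continuous_comp _ _ _ (fun x => (x, y)) H1); last exact: cH1.
  by apply: continuous_pair => ?; [exact: cvg_id|exact: cvg_cst].
- by move=> x /f0[fx dfx]; rewrite /H1/= fx dfx; split; ring.
Qed.

Let intH2 : (\int[(leb \x leb)%E]_z (H2 z)%:E = 0)%E.
Proof.
have := integral12_prod_meas1 iH2; rewrite /fubini_F/= => <-.
apply: integral0_eq => x _.
apply: (@integral_derivative_compact (fun y => g y * psi (x, y) * df x) _ M).
- move=> y; have p' := @is_derive_snd psi x y (smooth_derivable spsi _ _).
  have := @is_deriveM _ _ _ _ y 1 _ _ (is_deriveM (g' y) p') (is_derive_cst (df x) y 1).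
  move=> H; apply: (is_derive_eq H); rewrite /H2/= scaler0 add0r /GRing.scale/=; ring.
- move=> y; apply: (@continuous_comp _ _ _ (fun y => (x, y)) H2); last exact: cH2.
  by apply: continuous_pair => ?; [exact: cvg_cst|exact: cvg_id].
- by move=> y /g0[gy dgy]; rewrite /H2/= gy dgy; split; ring.
Qed.

(** The field with stream function [f x * g y], paired with the gradient of [psi]. *)
Definition skew_integrand (z : R * R) : R :=
  f z.1 * dg z.2 * 'D_(1, 0) psi z - df z.1 * g z.2 * 'D_(0, 1) psi z.

Let skewE : EFin \o skew_integrand = ((EFin \o H1) \- (EFin \o H2))%E.
Proof.
apply/funext => z; rewrite /skew_integrand /H1 /H2/= -EFinB; congr EFin; ring.
Qed.

Lemma integrable_skew : (leb \x leb)%E.-integrable setT (EFin \o skew_integrand).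
Proof. by rewrite skewE; exact: integrableB. Qed.

Lemma integral_skew : (\int[(leb \x leb)%E]_z (skew_integrand z)%:E = 0)%E.
Proof.
transitivity (\int[(leb \x leb)%E]_z ((EFin \o H1) z - (EFin \o H2) z))%E.
  by rewrite -[X in integral _ _ X]/(EFin \o skew_integrand) skewE.
by rewrite integralB//= intH1 intH2 subee.
Qed.

End skew_product.

(** * Chain rule along a trajectory *)

Lemma mean_value_line {V : normedModType R} (f : V -> R) (q e : V) (d : R) :
  (forall x, derivable f x e) ->
  exists2 c, `|c| <= `|d| & f (q + d *: e) - f q = 'D_e f (q + c *: e) * d.
Proof.
move=> fe; pose g s := f (q + s *: e).
have g' (s : R) : is_derive s 1 g ('D_e f (q + s *: e)) by exact: is_derive_line.
have cg : continuous g := continuous_derive g'.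
have g0 : g 0 = f q by rewrite /g scale0r addr0.
have [d0|/ltW d0] := leP 0 d.
  have [c + H] := MVT_segment d0 (fun s _ => g' s) (continuous_subspaceT cg).
  rewrite in_itv/= => /andP[c0 cd]; exists c; first by rewrite !ger0_norm.
  by rewrite -g0 -/(g d) H subr0.
have [c + H] := MVT_segment d0 (fun s _ => g' s) (continuous_subspaceT cg).
rewrite in_itv/= => /andP[cd c0]; exists c; first by rewrite !ler0_norm// lerN2.
by rewrite -g0 -/(g d) -opprB H sub0r mulrN opprK.
Qed.

(** The base point [q h] moves with [h]; the mean value theorem and the continuity of the
    directional derivative at [p] absorb this. *)
Lemma cvg_increment {V : normedModType R} (f : V -> R) (e p : V) (q : R -> V)
    (d : R -> R) (a : R) :
  (forall x, derivable f x e) -> {for p, continuous ('D_e f)} ->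
  q h @[h --> 0^'] --> p -> d h @[h --> 0^'] --> 0 ->
  h^-1 * d h @[h --> 0^'] --> a ->
  h^-1 * (f (q h + d h *: e) - f (q h)) @[h --> 0^'] --> a * 'D_e f p.
Proof.
move=> fe cf qp d0 da.
have /choice[c cP] : forall h, exists c, `|c| <= `|d h| /\
    f (q h + d h *: e) - f (q h) = 'D_e f (q h + c *: e) * d h.
  by move=> h; have [c ? ?] := mean_value_line (q h) (d h) fe; exists c.
have c0 : c h @[h --> 0^'] --> 0.
  apply/cvgr0Pnorm_le => eps eps0; move/cvgr0Pnorm_le : d0 => /(_ _ eps0).
  by apply: filterS => h; apply: le_trans; exact: (cP h).1.
have qc : q h + c h *: e @[h --> 0^'] --> p.
  rewrite -[p]addr0 -[X in _ + X](scale0r e).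
  by apply: cvgD => //; apply: cvgZr_tmp.
rewrite (_ : (fun h => _) = fun h => (h^-1 * d h) * 'D_e f (q h + c h *: e)).
  by apply: cvgM => //; exact: (cvg_comp _ _ qc cf).
by apply/funext => h; rewrite (cP h).2 mulrA mulrAC.
Qed.

(** As [smooth] speaks of directional derivatives, the increment is split into three moves parallel
    to the axes: time first, then the first and the second coordinate. *)
Lemma is_derive_along (f : R * (R * R) -> R) (X Y : R -> R) (t a b : R) :
  smooth f -> is_derive t 1 X a -> is_derive t 1 Y b ->
  is_derive t 1 (fun s => f (s, (X s, Y s)))
    ('D_(1, (0, 0)) f (t, (X t, Y t)) + (a * 'D_(0, (1, 0)) f (t, (X t, Y t))
     + b * 'D_(0, (0, 1)) f (t, (X t, Y t)))).
Proof.
move=> sf dX dY.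
have quot (Z : R -> R) c : is_derive t 1 Z c ->
    h^-1 * (Z (h + t) - Z t) @[h --> 0^'] --> c.
  move=> [/cvg_ex[L hL] <-]; have -> : 'D_1 Z t = L by exact/cvg_lim.
  by move: hL; under eq_fun do rewrite /= [_ *: 1]mulr1.
have h0 : (h : R) @[h --> 0^'] --> 0 by exact: nbhs_dnbhs.
have incr (Z : R -> R) c : is_derive t 1 Z c -> Z (h + t) - Z t @[h --> 0^'] --> 0.
  move=> /quot H; rewrite -[X in _ --> X](mul0r c).
  apply: cvg_trans (cvgM h0 H); apply: near_eq_cvg.
  near=> h; rewrite /= mulrA mulfV ?mul1r//; near: h; exact: nbhs_dnbhs_neq.
have conv (Z : R -> R) c : is_derive t 1 Z c -> Z (h + t) @[h --> 0^'] --> Z t.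
  move=> /incr H; rewrite -[X in _ --> X]add0r.
  rewrite (_ : (fun h => _) = fun h => Z (h + t) - Z t + Z t).
    by apply: cvgD => //; exact: cvg_cst.
  by apply/funext => h; rewrite subrK.
set p := (t, (X t, Y t)).
have der := smooth_derivable sf; have cder := smooth_continuous_derive sf.
have cvg2 (U V : topologicalType) (f1 : R -> U) (f2 : R -> V) (c1 : U) (c2 : V) :
    f1 h @[h --> 0^'] --> c1 -> f2 h @[h --> 0^'] --> c2 ->
    (f1 h, f2 h) @[h --> 0^'] --> (c1, c2).
  by move=> H1 H2; exact: (cvg_pair H1 H2).
have ct : (fun=> t : R) h @[h --> (0 : R)^'] --> t by exact: cvg_cst.
have cXt : (fun=> X t : R) h @[h --> (0 : R)^'] --> X t by exact: cvg_cst.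
have q1 : (t, (X (h + t), Y (h + t))) @[h --> 0^'] --> p.
  exact: (cvg2 _ _ _ _ _ _ ct (cvg2 _ _ _ _ _ _ (conv _ _ dX) (conv _ _ dY))).
have q2 : (t, (X t, Y (h + t))) @[h --> 0^'] --> p.
  exact: (cvg2 _ _ _ _ _ _ ct (cvg2 _ _ _ _ _ _ cXt (conv _ _ dY))).
have one : h^-1 * h @[h --> (0 : R)^'] --> (1 : R).
  have c1 : (fun=> 1 : R) h @[h --> (0 : R)^'] --> (1 : R) by exact: cvg_cst.
  apply: cvg_trans c1; apply: near_eq_cvg.
  near=> h; rewrite mulVf//; near: h; exact: nbhs_dnbhs_neq.
have L1 := cvg_increment (fun x => der x (1, (0, 0))) (@cder (1, (0, 0)) p) q1 h0 one.
have L2 := cvg_increment (fun x => der x (0, (1, 0))) (@cder (0, (1, 0)) p) q2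
  (incr _ _ dX) (quot _ _ dX).
have cp : (fun=> p) h @[h --> (0 : R)^'] --> p by exact: cvg_cst.
have L3 := cvg_increment (fun x => der x (0, (0, 1))) (@cder (0, (0, 1)) p)
  cp (incr _ _ dY) (quot _ _ dY).
have := cvgD L1 (cvgD L2 L3); rewrite mul1r => L.
set D := (X in is_derive _ _ _ X).
suff E : h^-1 *: (f (h *: 1 + t, (X (h *: 1 + t), Y (h *: 1 + t))) - f p) @[h --> 0^'] --> D.
  by apply: DeriveDef; [apply/cvg_ex; exists D|exact/cvg_lim].
have F0 : Filter ((0 : R)^') by typeclasses eauto.
have {}L := L F0 F0; move: L.
set G := (X in X x @[x --> _] --> _ -> _).
suff -> : G = (fun h : R =>
    h^-1 *: (f (h *: 1 + t, (X (h *: 1 + t), Y (h *: 1 + t))) - f p)) by [].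
rewrite /G.
have e1 (h : R) (z : R * R) : (t, z) + h *: (1, (0, 0)) = (h + t, z).
  case: z => z1 z2; congr (_, (_, _)); rewrite /= /GRing.scale/= ?mulr0 ?addr0//.
  by rewrite mulr1 addrC.
have e2 (h y : R) : (t, (X t, y)) + h *: (0, (1, 0)) = (t, (h + X t, y)).
  congr (_, (_, _)); rewrite /= /GRing.scale/= ?mulr0 ?addr0//.
  by rewrite mulr1 addrC.
have e3 (h : R) : p + h *: (0, (0, 1)) = (t, (X t, h + Y t)).
  congr (_, (_, _)); rewrite /= /GRing.scale/= ?mulr0 ?addr0//.
  by rewrite mulr1 addrC.
apply/funext => h; rewrite !fctE/= e1 e2 e3 !subrK [h%:A]mulr1 -!mulrDr.
by congr (_ * _); rewrite /p; ring.
Unshelve. all: by end_near. Qed.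

End integration.

Lemma balance {R : realType} (a b : \bar R) (c d : R) :
  a \is a fin_num -> b \is a fin_num ->
  (a + b = c%:E - d%:E)%E -> (a - c%:E + d%:E + b = 0)%E.
Proof.
move: a b => [a| |] [b| |]// _ _; rewrite -!EFinB -!EFinD => -[E].
by congr EFin; lra.
Qed.

(** * Advection of a discrete measure *)

Section advection.
Context {R : realType} (u : R * (R * R) -> R * R) (X Y : nat -> R -> R).
Variables (B : R) (nu : {finite_measure set nat -> \bar R}).
Hypotheses (cu : continuous u)
  (cX : forall n, continuous (X n)) (cY : forall n, continuous (Y n))
  (bX : forall n (t : R), `|X n t| <= B) (bY : forall n (t : R), `|Y n t| <= B)
  (odeX : forall n (t : R), 0 < t -> is_derive t 1 (X n) (u (t, (X n t, Y n t))).1)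
  (odeY : forall n (t : R), 0 < t -> is_derive t 1 (Y n) (u (t, (X n t, Y n t))).2).

(* [nu] weighs labels [n], whose particles move along the flow lines [(X n, Y n)]. *)
Definition cloud t : nat -> R * R := fun n => (X n t, Y n t).

Lemma measurable_cloud t : measurable_fun setT (cloud t).
Proof. by []. Qed.

Definition cloud_measure t : {measure set (R * R) -> \bar R} :=
  measure_function_pushforward__canonical__measure_function_Measure nu
    (measurable_cloud t).

Lemma cloud_measureE t A : cloud_measure t A = nu (cloud t @^-1` A).
Proof. by []. Qed.

Section observable.
Variables (T : R) (F : R * (R * R) -> R).
Hypothesis cF : continuous F.

(** Times start at -1, and [T] will be enlarged by 1, so that both ends of the interval of interest
    are interior points. *)
Lemma observable_bound : exists C, 0 <= C /\
  forall t n, -1 <= t -> t <= T -> `|F (t, cloud t n)| <= C.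
Proof.
have cK : compact (`[-1, T]%classic `*` (`[- B, B]%classic `*` `[- B, B]%classic)
    : set (R * (R * R))).
  by apply: compact_setX; [|apply: compact_setX]; exact: segment_compact.
have := @continuous_compact _ _ F _ (continuous_subspaceT cF) cK.
move=> /compact_bounded[C [_ HC]]; exists (`|C| + 1); split; first by rewrite addr_ge0.
move=> t n t0 tT; apply: (HC (`|C| + 1)); first by rewrite ltr_pwDr// ler_norm.
exists (t, cloud t n) => //; split; [|split]; rewrite /= in_itv/= ?t0//.
- by rewrite -ler_norml.
- by rewrite -ler_norml.
Qed.

Lemma continuous_observable n : continuous (fun t => F (t, cloud t n)).
Proof.
move=> t; apply: (@continuous_comp _ _ _ (fun t => (t, cloud t n)) F); last exact: cF.
apply: (@continuous_pair _ _ _ id (fun t => cloud t n)) => s; first exact: cvg_id.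
by apply: continuous_pair; [exact: cX|exact: cY].
Qed.

Definition mean t : R := \int[nu]_(n in setT) F (t, cloud t n).

Lemma integrable_observable t : -1 <= t -> t <= T ->
  nu.-integrable setT (EFin \o (fun n => F (t, cloud t n))).
Proof.
move=> t0 tT; apply: measurable_bounded_integrable => //.
  by apply: fin_num_fun_lty => //; exact: fin_num_measure.
have [C [C0 HC]] := observable_bound; exists C; split; first exact: num_real.
by move=> C' CC' n _ /=; rewrite (le_trans (HC t n t0 tT))// ltW.
Qed.

Lemma integral_cloud t : -1 <= t -> t <= T ->
  (\int[cloud_measure t]_x (F (t, x))%:E)%E = (mean t)%:E.
Proof.
move=> t0 tT.
have iF := integrable_observable t0 tT.
rewrite /cloud_measure /mean /Rintegral fineK; last exact: integrable_fin_num.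
rewrite (integral_pushforward (measurable_cloud t))//.
apply/measurable_EFinP; apply: continuous_plane_measurable => z.
apply: (@continuous_comp _ _ _ (fun x => (t, x)) F); last exact: cF.
by apply: continuous_pair => ?; [exact: cvg_cst|exact: cvg_id].
Qed.

Lemma continuous_mean t : -1 < t -> t < T -> {for t, continuous mean}.
Proof.
move=> t0 tT; have [C [C0 HC]] := observable_bound.
apply: (@continuity_under_integral _ _ _ nu (fun t n => F (t, cloud t n)) setT
  measurableT (-1) T _ _ (fun=> C)).
- move=> s; rewrite /= in_itv/= => /andP[s0 sT].
  by apply: integrable_observable; exact: ltW.
- by apply: aeW => n _ s _; exact: continuous_observable.
- apply: measurable_bounded_integrable => //.
    by apply: fin_num_fun_lty => //; exact: fin_num_measure.
  exact: bounded_cst.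
- move=> s; rewrite /= in_itv/= => /andP[s0 sT]; apply: aeW => n _.
  by apply: HC; exact: ltW.
- by rewrite inE/= in_itv/= t0.
Qed.

End observable.

(** By the chain rule along each trajectory and differentiation under the integral, [mean phi] has
    derivative [mean (dt phi) + mean (udotgrad u phi)] at positive times; the weak formulation is
    its integral over [[0, T]]. *)
Lemma advected T : 0 < T -> weakly_advected T cloud_measure u.
Proof.
move=> T0 phi [sphi _].
have cphi := smooth_continuous sphi.
have c1 : continuous (dt phi) by exact: smooth_continuous_derive.
have c2 : continuous (udotgrad u phi).
  move=> p; apply: cvgD; apply: cvgM.
  - by apply: cvg_comp; [exact: cu|exact: cvg_fst].
  - exact: smooth_continuous_derive.
  - by apply: cvg_comp; [exact: cu|exact: cvg_snd].
  - exact: smooth_continuous_derive.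
move=> A B'.
have T1 : T <= T + 1 by rewrite lerDl.
have T1' : T < T + 1 by rewrite ltrDl.
have inT t : `[0%R, T]%classic t -> [/\ -1 < t, t < T + 1 & (-1 <= t) && (t <= T + 1)].
  by rewrite /= in_itv/= => /andP[? ?]; split; [lra|lra|apply/andP; split; lra].
have AE t : `[0%R, T]%classic t -> A t = (mean (dt phi) t)%:E.
  by move=> /inT[_ _ /andP[? ?]]; exact: (integral_cloud (T := T + 1)).
have BE t : `[0%R, T]%classic t -> B' t = (mean (udotgrad u phi) t)%:E.
  by move=> /inT[_ _ /andP[? ?]]; exact: (integral_cloud (T := T + 1)).
have wc F : continuous F -> {within `[0%R, T], continuous (mean F)}.
  move=> cF; apply: continuous_in_subspaceT => t; rewrite inE => /inT[? ? _].
  exact: (continuous_mean (T := T + 1)).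
have iA : lebesgue_measure.-integrable `[0%R, T] (EFin \o mean (dt phi)).
  by apply: continuous_compact_integrable; [exact: segment_compact|exact: wc].
have iB : lebesgue_measure.-integrable `[0%R, T] (EFin \o mean (udotgrad u phi)).
  by apply: continuous_compact_integrable; [exact: segment_compact|exact: wc].
have iA' : lebesgue_measure.-integrable `[0%R, T] A.
  by apply: eq_integrable iA => // t; rewrite inE => /AE ->.
have iB' : lebesgue_measure.-integrable `[0%R, T] B'.
  by apply: eq_integrable iB => // t; rewrite inE => /BE ->.
split => //.
pose g t := mean (dt phi) t + mean (udotgrad u phi) t.
have wg : {within `[0%R, T], continuous g}.
  by move=> t; apply: cvgD; exact: wc.
have dphi n (t : R) : 0 < t -> is_derive t 1 (fun s => phi (s, cloud s n))
    (dt phi (t, cloud t n) + udotgrad u phi (t, cloud t n)).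
  move=> t0; have := is_derive_along sphi (odeX n t0) (odeY n t0).
  by move=> H; apply: (is_derive_eq H); rewrite /dt /udotgrad addrA.
have [C1 [C10 HC1]] := observable_bound (T + 1) c1.
have [C2 [C20 HC2]] := observable_bound (T + 1) c2.
have intphi x : `]0%R, T + 1[%classic x ->
    nu.-integrable setT (EFin \o (fun n => phi (x, cloud x n))).
  rewrite /= in_itv/= => /andP[? ?]; apply: (integrable_observable (T := T + 1)) => //; lra.
have derphi x n : `]0%R, T + 1[%classic x -> setT n ->
    derivable (fun s => phi (s, cloud s n)) x 1.
  by rewrite /= in_itv/= => /andP[x0 _] _; case: (dphi n x x0).
have boundphi x n : `]0%R, T + 1[%classic x -> setT n ->
    `|partial1of2 (fun s n => phi (s, cloud s n)) x n| <= C1 + C2.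
  rewrite /= in_itv/= => /andP[x0 xT] _; rewrite partial1of2E.
  rewrite (@derive_val _ _ _ _ _ _ _ (dphi n x x0)).
  have x1 : -1 <= x by apply: le_trans (ltW x0); rewrite lerN10.
  by rewrite (le_trans (ler_normD _ _))// lerD// ?HC1 ?HC2// ltW.
have intC : nu.-integrable setT (EFin \o (fun=> C1 + C2)).
  apply: measurable_bounded_integrable => //.
    by apply: fin_num_fun_lty => //; exact: fin_num_measure.
  exact: bounded_cst.
have der x : 0 < x -> x < T + 1 -> derivable (mean phi) x 1 /\ (mean phi)^`()%classic x = g x.
  move=> x0 xT; have Ix : `]0%R, T + 1[%classic x by rewrite /= in_itv/= x0.
  split.
    exact: (derivable_under_integral measurableT Ix intphi derphi
      (fun=> addr_ge0 C10 C20) intC boundphi).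
  rewrite [LHS](differentiation_under_integral measurableT Ix intphi derphi
      (fun=> addr_ge0 C10 C20) intC boundphi).
  rewrite /g /mean -RintegralD//; last 2 first.
  - by apply: (integrable_observable (T := T + 1)) => //; lra.
  - by apply: (integrable_observable (T := T + 1)) => //; lra.
  apply: eq_Rintegral => n _; rewrite partial1of2E.
  exact: (@derive_val _ _ _ _ _ _ _ (dphi n x x0)).
(* The trajectories satisfy the equation for [t > 0]; at time 0 continuity of [mean phi] is
   enough. *)
have ftc : (\int[lebesgue_measure]_(x in `[0%R, T]) (g x)%:E =
    (mean phi T)%:E - (mean phi 0)%:E)%E.
  apply: continuous_FTC2 => //.
  - split.
    + move=> x; rewrite in_itv/= => /andP[x0 xT]; apply: (der x x0 _).1.
      exact: lt_trans T1'.
    + apply: cvg_at_right_filter; apply: (continuous_mean (T := T + 1)) => //; lra.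
    + apply: cvg_at_left_filter; apply: (continuous_mean (T := T + 1)) => //; lra.
  - move=> x; rewrite in_itv/= => /andP[x0 xT]; apply: (der x x0 _).2.
    exact: lt_trans T1'.
have sumE : (\int[lebesgue_measure]_(x in `[0%R, T]) (g x)%:E =
    \int[lebesgue_measure]_(t in `[0%R, T]) A t +
    \int[lebesgue_measure]_(t in `[0%R, T]) B' t)%E.
  rewrite -integralD//; apply: eq_integral => t; rewrite inE => tT.
  by rewrite (AE _ tT) (BE _ tT).
have fA : (\int[lebesgue_measure]_(t in `[0%R, T]) A t)%E \is a fin_num.
  exact: integrable_fin_num.
have fB : (\int[lebesgue_measure]_(t in `[0%R, T]) B' t)%E \is a fin_num.
  exact: integrable_fin_num.
have ET : (\int[cloud_measure T]_x (phi (T, x))%:E)%E = (mean phi T)%:E.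
  by apply: (integral_cloud (T := T + 1)) => //; lra.
have E0 : (\int[cloud_measure 0]_x (phi (0, x))%:E)%E = (mean phi 0)%:E.
  by apply: (integral_cloud (T := T + 1)) => //; lra.
rewrite ET E0.
exact: (balance fA fB (etrans (esym sumE) ftc)).
Qed.

End advection.

(* MathComp-Analysis exports another [edist]. *)
Local Notation edist := Defs.edist.

(** * The Hausdorff dimension of the dust *)

Section diameter.
Context {R : realType}.
Implicit Types (A : set (R * R)) (x y : R * R).

Lemma edist_ge_fst x y : `|x.1 - y.1| <= edist x y.
Proof.
rewrite /edist -[leLHS]sqrtr_sqr ler_sqrt ?addr_ge0 ?sqr_ge0//.
by rewrite lerDl sqr_ge0.
Qed.

Lemma edist_ge_snd x y : `|x.2 - y.2| <= edist x y.
Proof.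
rewrite /edist -[leLHS]sqrtr_sqr ler_sqrt ?addr_ge0 ?sqr_ge0//.
by rewrite lerDr sqr_ge0.
Qed.

Lemma edist_le x y r : `|x.1 - y.1| <= r -> `|x.2 - y.2| <= r ->
  edist x y <= 2 * r.
Proof.
move=> h1 h2; have r0 : 0 <= r := le_trans (normr_ge0 _) h1.
have E : 2 * r = Num.sqrt ((2 * r) ^+ 2) by rewrite sqrtr_sqr ger0_norm// mulr_ge0.
rewrite E /edist ler_sqrt ?sqr_ge0//.
have H z : `|z| <= r -> z ^+ 2 <= r ^+ 2.
  move=> zr; rewrite -real_normK ?num_real// lerXn2r// ?nnegrE//.
by have := H _ h1; have := H _ h2; have := sqr_ge0 r; rewrite exprMn; lra.
Qed.

Lemma diam_ge0 A : (0 <= diam A)%E.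
Proof. by apply: ereal_sup_ubound; left. Qed.

Lemma diam_set0 : diam (set0 : set (R * R)) = 0%E.
Proof.
apply/eqP; rewrite eq_le diam_ge0 andbT; apply: ge_ereal_sup => z [->//|[x []]].
Qed.

Lemma diam_le A (d : R) : 0 <= d -> (forall x y, A x -> A y -> edist x y <= d) ->
  (diam A <= d%:E)%E.
Proof.
move=> d0 H; apply: ge_ereal_sup => z [->|]; first by rewrite lee_fin.
by move=> [x Ax [y Ay <-]]; rewrite lee_fin; exact: H.
Qed.

Lemma edist_le_diam A x y : A x -> A y -> ((edist x y)%:E <= diam A)%E.
Proof. by move=> Ax Ay; apply: ereal_sup_ubound; right; exists x => //; exists y. Qed.

End diameter.

(** * Binary expansions of numbers in [[0, 1)] *)

Section binary_digits.
Context {R : realType}.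
Implicit Types z : R.

Definition bit z n : bool := odd (Num.truncn (2 ^+ n.+1 * z)).

Lemma truncn_double z : 0 <= z ->
  Num.truncn (2 * z) = (odd (Num.truncn (2 * z)) + (Num.truncn z).*2)%N.
Proof.
move=> z0; have /andP[a b] := truncn_itv z0.
have z20 : 0 <= 2 * z by rewrite mulr_ge0.
have /andP[c d] := truncn_itv z20.
rewrite -[LHS]odd_double_half; congr (_ + _.*2)%N.
set N := Num.truncn z in a b *; set M := Num.truncn (2 * z) in c d *.
apply/eqP; rewrite eqn_leq; apply/andP; split.
  have : (M < N.+1.*2)%N.
    rewrite -(ltr_nat R) -muln2 natrM; apply: le_lt_trans c _; lra.
  by lia.
have : (N.*2 < M.+1)%N.
  rewrite -(ltr_nat R) -muln2 natrM; apply: le_lt_trans d; lra.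
by lia.
Qed.

Lemma same_bits n z z' : 0 <= z < 1 -> 0 <= z' < 1 ->
  (forall m, (m < n)%N -> bit z m = bit z' m) ->
  Num.truncn (2 ^+ n * z) = Num.truncn (2 ^+ n * z').
Proof.
move=> /andP[z0 z1] /andP[z0' z1']; elim: n => [|n IH] H.
  rewrite expr0 !mul1r.
  by rewrite (truncn_def (n := 0)) ?z0// (truncn_def (n := 0)) ?z0'.
rewrite exprS -!mulrA truncn_double ?mulr_ge0 ?exprn_ge0//.
rewrite [RHS]truncn_double ?mulr_ge0 ?exprn_ge0// IH; last first.
  by move=> m mn; apply: H; rewrite ltnS ltnW.
by rewrite !mulrA -exprS; have := H n (ltnSn n); rewrite /bit => ->.
Qed.

Lemma same_bits_dist n z z' : 0 <= z < 1 -> 0 <= z' < 1 ->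
  (forall m, (m < n)%N -> bit z m = bit z' m) -> `|z - z'| <= (2 ^+ n)^-1.
Proof.
move=> zi zi' /(same_bits zi zi') H.
move: zi zi' => /andP[z0 z1] /andP[z0' z1'].
have p0 : 0 < 2 ^+ n :> R by rewrite exprn_gt0.
have /andP[a b] := truncn_itv (mulr_ge0 (ltW p0) z0).
have /andP[c d] := truncn_itv (mulr_ge0 (ltW p0) z0').
rewrite H in a b; rewrite -[leRHS]mul1r ler_pdivlMr//.
rewrite -(ger0_norm (ltW p0)) -normrM ler_norml mulrC mulrBr.
by apply/andP; split; lra.
Qed.

End binary_digits.

(** * Dimension of a dust with separated digits *)

Section cantor_dust.
Context {R : realType} (l h G : R) (a : nat -> R).
Hypotheses (l0 : 0 < l) (l1 : l < 2^-1) (h0 : 0 < h) (lh : l `^ h = 4^-1)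
  (a0 : forall j, 0 <= a j) (al : forall j, a j <= l ^+ j) (G0 : 0 < G)
  (gap : forall n J, \sum_(n.+1 <= j < J) a j <= a n - G * l ^+ n).

Definition psum (e : nat -> bool) n : R := \sum_(j < n) a j * (e j)%:R.
Definition dust : set (R * R) := closure [set z | exists e e' n, z = (psum e n, psum e' n)].

Let l2 : 0 < 1 - l. Proof. by move: (l0) (l1) => ? ?; lra. Qed.

Lemma psum_split e m n : (m <= n)%N ->
  psum e n = psum e m + \sum_(m <= j < n) a j * (e j)%:R.
Proof.
by move=> mn; rewrite /psum -!(big_mkord xpredT (fun j => a j * (e j)%:R)) (big_cat_nat (n := m)).
Qed.

Lemma tail_ge0 (e : nat -> bool) m n : 0 <= \sum_(m <= j < n) a j * (e j)%:R.
Proof. by apply: sumr_ge0 => j _; rewrite mulr_ge0. Qed.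

Lemma tail_le_sum (e : nat -> bool) m n :
  \sum_(m <= j < n) a j * (e j)%:R <= \sum_(m <= j < n) a j.
Proof. by apply: ler_sum => j _; case: (e j); rewrite ?mulr1// mulr0. Qed.

Lemma tail_le (e : nat -> bool) m n :
  \sum_(m <= j < n) a j * (e j)%:R <= l ^+ m / (1 - l).
Proof.
apply: le_trans (tail_le_sum e m n) (le_trans _ (geometric_le l0 l1 m n)).
exact: ler_sum.
Qed.

Lemma powR_exprn (x s : R) n : 0 < x -> (x ^+ n) `^ s = (x `^ s) ^+ n.
Proof.
move=> x0; elim: n => [|n IH]; first by rewrite !expr0 powR1.
by rewrite !exprS powRM ?IH ?exprn_ge0 ?(ltW x0).
Qed.

Section upper_bound.
Variable m : nat.
Let tau : R := l ^+ m / (1 - l).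
Let tau0 : 0 < tau. Proof. by rewrite divr_gt0// exprn_gt0. Qed.

Definition box (c : R * R) : set (R * R) :=
  `[c.1, c.1 + tau]%classic `*` `[c.2, c.2 + tau]%classic.

Lemma closed_box c : closed (box c).
Proof.
by apply: closedI; apply: closed_comp => // [z _|]; first [exact: cvg_fst|exact: cvg_snd|exact: interval_closed].
Qed.

Lemma diam_box c : (diam (box c) <= (2 * tau)%:E)%E.
Proof.
apply: diam_le; first by rewrite mulr_ge0 ?(ltW tau0).
move=> x y [/= +  +] [/= + +]; rewrite !in_itv/=.
move=> /andP[? ?] /andP[? ?] /andP[? ?] /andP[? ?].
by apply: edist_le; rewrite ler_norml; apply/andP; split; lra.
Qed.

Definition corner (s : seq (bool * bool)) : R * R :=
  (psum (fun j => (nth (false, false) s j).1) m,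
   psum (fun j => (nth (false, false) s j).2) m).

Definition corners : seq (R * R) := [seq corner (tval s) | s : m.-tuple (bool * bool)].

Lemma size_corners : size corners = (4 ^ m)%N.
Proof. by rewrite size_image card_tuple card_prod card_bool. Qed.

(** A finite sum lies in the box whose corner is given by its first [m] digits; a finite union of
    closed boxes is closed, so it contains the closure as well. *)
Lemma dust_boxes z : dust z -> exists2 c, c \in corners & box c z.
Proof.
suff H : dust `<=` [set z | exists2 c, c \in corners & box c z] by exact: H.
have cl : closed [set z | exists2 c, c \in corners & box c z].
  elim: corners => [|c L IH].
    rewrite (_ : [set z | exists2 c, c \in [::] & box c z] = set0); first exact: closed0.
    by apply/seteqP; split => // ? [].
  rewrite (_ : [set _ | _] = box c `|` [set z | exists2 c, c \in L & box c z]).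
    by apply: closedU => //; exact: closed_box.
  apply/seteqP; split => [x [c']|x [cx|[c' c'L cx]]].
  - rewrite inE => /orP[/eqP -> ?|? ?]; first by left.
    by right; exists c'.
  - by exists c => //; rewrite mem_head.
  - by exists c' => //; rewrite inE c'L orbT.
rewrite /dust closureE; apply: bigcap_inf; split => // x [e [e' [n ->]]].
pose s := [tuple (if (j < n)%N then e j else false, if (j < n)%N then e' j else false) | j < m].
exists (corner s); first by apply/fintype.imageP; exists s.
have sE (f : nat -> bool) (g : bool * bool -> bool) :
    (forall j, g (if (j < n)%N then e j else false, if (j < n)%N then e' j else false) =
      if (j < n)%N then f j else false) ->
    psum (fun j => g (nth (false, false) s j)) m <= psum f n <=
    psum (fun j => g (nth (false, false) s j)) m + tau.
  move=> gf.
  have fn : psum f n = psum (fun j => if (j < n)%N then f j else false) (maxn m n).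
    rewrite [RHS](@psum_split _ n (maxn m n)) ?leq_maxr// big1_seq ?addr0.
      by apply: eq_bigr => j _; rewrite ltn_ord.
    by move=> j; rewrite mem_index_iota => /andP[_ /andP[nj _]]; rewrite ltnNge nj mulr0.
  rewrite fn (@psum_split _ m (maxn m n)) ?leq_maxl//.
  have -> : psum (fun j => if (j < n)%N then f j else false) m =
      psum (fun j => g (nth (false, false) s j)) m.
    apply: eq_bigr => j _; congr (_ * (nat_of_bool _)%:R).
    by rewrite -gf -tnth_nth tnth_mktuple.
  by rewrite lerDl tail_ge0/= lerD2l tail_le.
split; rewrite /= in_itv/=.
  by apply: (sE e (fun b => b.1)).
by apply: (sE e' (fun b => b.2)).
Qed.

Lemma hausdorff_approx_dust s d : 0 < s -> 2 * tau <= d ->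
  (hausdorff_approx s d dust <= ((4 ^+ m) * (2 * tau) `^ s)%:E)%E.
Proof.
move=> s0 td.
pose F i := if (i < 4 ^ m)%N then box (nth (0, 0) corners i) else set0.
have dF i : (diam (F i) <= (2 * tau)%:E)%E.
  rewrite /F; case: ifP => _; first exact: diam_box.
  by rewrite diam_set0 lee_fin mulr_ge0 ?(ltW tau0).
apply: (@le_trans _ _ (\sum_(0 <= i <oo) ((fine (diam (F i))) `^ s)%:E)%E).
  apply: ereal_inf_lbound; exists F => //; split.
    move=> z /dust_boxes[c cL cz]; exists (index c corners) => //.
    by rewrite /F -size_corners index_mem cL nth_index.
  by move=> i; apply: le_trans (dF i) _; rewrite lee_fin.
rewrite (nneseries_split 0 (4 ^ m)); last by move=> k _; rewrite lee_fin powR_ge0.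
rewrite add0n [X in (_ + X)%E]eseries0 ?adde0; last first.
  (* The empty sets completing the cover cost nothing because [s] is positive. *)
  move=> i /= ni _; rewrite /F ltnNge ni/= diam_set0/= powR0//.
  by rewrite gt_eqF.
rewrite sumEFin lee_fin.
apply: (@le_trans _ _ (\sum_(0 <= i < 4 ^ m) (2 * tau) `^ s)).
  apply: ler_sum => i _; apply: ge0_ler_powR; rewrite ?nnegrE//.
  - exact: ltW.
  - by rewrite fine_ge0// diam_ge0.
  - by rewrite mulr_ge0// ltW.
  - by rewrite -lee_fin fineK// ge0_fin_numE ?diam_ge0// (le_lt_trans (dF i))// ltry.
by rewrite sumr_const_nat subn0 -[leLHS]mulr_natl natrX.
Qed.

End upper_bound.

Lemma exprn_small (x e : R) : 0 <= x -> x < 1 -> 0 < e -> \forall n \near \oo, x ^+ n <= e.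
Proof.
move=> x0 x1 e0.
have /cvgrPdist_le/(_ _ e0) : (fun n => x ^+ n : R) @ \oo --> 0.
  by apply: cvg_expr; rewrite ger0_norm.
by apply: filterS => n; rewrite sub0r normrN ger0_norm// exprn_ge0.
Qed.

(** The cover by [4 ^ m] boxes costs a constant times the [m]-th power of 4 l^s, which is less than
    1 since 4 l^h = 1 and [h < s]. *)
Lemma hausdorff_measure_dust s : h < s -> hausdorff_measure s dust = 0%E.
Proof.
move=> hs; have s0 := lt_trans h0 hs.
have ls : 4 * l `^ s < 1.
  have -> : s = h + (s - h) by rewrite addrC subrK.
  rewrite powRD; last by apply/implyP => _; rewrite lt0r_neq0.
  have e1 : 1 `^ (s - h) = 1 :> R by rewrite powR1.
  rewrite lh mulrA mulfV// mul1r -[ltRHS]e1.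
  apply: gt0_ltr_powR; rewrite ?nnegrE ?subr_gt0//; first exact: ltW.
  by move: (l1) => ?; lra.
have ls0 : 0 <= 4 * l `^ s by rewrite mulr_ge0// powR_ge0.
apply/eqP; rewrite eq_le; apply/andP; split; last first.
  apply: (@le_trans _ _ (hausdorff_approx s 1 dust)).
    apply: le_ereal_inf_tmp => _ [F _ <-].
    by apply: nneseries_ge0 => i _ _; rewrite lee_fin powR_ge0.
  by apply: ereal_sup_ubound; exists 1 => //=.
apply: ge_ereal_sup => _ [d /= d0 <-].
apply/lee_addgt0Pr => e e0; rewrite add0e.
pose C : R := (2 / (1 - l)) `^ s.
have C0 : 0 <= C by exact: powR_ge0.
have e1 : 0 < e / (C + 1) by rewrite divr_gt0// ltr_wpDl.
have d1 : 0 < d * (1 - l) / 2 by rewrite divr_gt0// mulr_gt0.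
have l1' : l < 1 by move: (l1) => ?; lra.
near \oo => m.
apply: (@le_trans _ _ ((4 ^+ m) * (2 * (l ^+ m / (1 - l))) `^ s)%:E).
  apply: hausdorff_approx_dust => //.
  rewrite mulrA ler_pdivrMr// -ler_pdivlMl//.
  have : l ^+ m <= d * (1 - l) / 2.
    by near: m; apply: exprn_small => //; exact: ltW.
  by rewrite mulrC.
rewrite lee_fin.
have -> : 2 * (l ^+ m / (1 - l)) = (2 / (1 - l)) * l ^+ m by rewrite mulrAC mulrA.
have lm0 : 0 <= l ^+ m by rewrite exprn_ge0// ltW.
rewrite powRM//; last by rewrite divr_ge0// ltW.
rewrite powR_exprn// mulrCA -exprMn -/C.
have : (4 * l `^ s) ^+ m <= e / (C + 1).
  by near: m; apply: exprn_small.
rewrite ler_pdivlMr ?ltr_wpDl// => /(le_trans _); apply.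
by rewrite mulrC ler_wpM2l ?exprn_ge0// lerDl.
Unshelve. all: by end_near. Qed.

Section lower_bound.

Lemma psum_nondecreasing e : nondecreasing_seq (psum e).
Proof. by move=> m n mn; rewrite (psum_split e mn) lerDl tail_ge0. Qed.

Lemma psum_cvg e : cvgn (psum e).
Proof.
apply: nondecreasing_is_cvgn; first exact: psum_nondecreasing.
exists (1 / (1 - l)) => _ [n _ <-].
by rewrite /psum -(big_mkord xpredT (fun j => a j * (e j)%:R)) (le_trans (tail_le e 0 n))// expr0.
Qed.

Lemma dust_limit e e' : dust (limn (psum e), limn (psum e')).
Proof.
have c1 : cvgn (psum e) by exact: psum_cvg.
have c2 : cvgn (psum e') by exact: psum_cvg.
apply: (@closed_cvg _ _ \oo _ (fun n => (psum e n, psum e' n)) dust).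
- exact: closed_closure.
- by apply: nearW => n; apply: subset_closure; exists e, e', n.
- exact: (cvg_pair c1 c2).
Qed.

(** The sequence with digit 1 at place [n] gains [a n], while the other can recover at most
    [a n - G * l ^+ n] later. *)
Lemma psum_separated (e e' : nat -> bool) n :
  (forall j, (j < n)%N -> e j = e' j) -> e n != e' n ->
  G * l ^+ n <= `|limn (psum e) - limn (psum e')|.
Proof.
wlog : e e' / e n = true.
  move=> W ee' en; case: (boolP (e n)) => [|/negbTE] et; first exact: W.
  rewrite distrC; apply: W => [|j jn|]; last by rewrite eq_sym.
    by move: en; rewrite et; case: (e' n).
  by rewrite ee'.
move=> en ee'; rewrite en; case: (boolP (e' n)) => // /negbTE en' _.
apply: le_trans (ler_norm _); rewrite lerBrDr.
have H J : (n < J)%N -> G * l ^+ n + psum e' J <= psum e J.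
  move=> nJ; rewrite (psum_split e (ltnW nJ)) (psum_split e' (ltnW nJ)).
  have -> : psum e n = psum e' n by apply: eq_bigr => j _; rewrite ee'.
  rewrite !(big_ltn nJ) en en' mulr1 mulr0 add0r addrCA lerD2l.
  have := tail_ge0 e n.+1 J; have := tail_le_sum e' n.+1 J; have := gap n J; lra.
rewrite addrC -lerBrDr; apply: limr_le; first exact: psum_cvg.
near=> J; rewrite lerBrDr addrC.
apply: (le_trans (H J _)).
  near: J; exact: nbhs_infty_gt.
by apply: nondecreasing_cvgn_le; [exact: psum_nondecreasing|exact: psum_cvg].
Unshelve. all: by end_near. Qed.

(* Even binary digits of [z] drive the first coordinate, odd ones the second. *)
Definition dpoint (z : R) : R * R :=
  (limn (psum (fun j => bit z j.*2)), limn (psum (fun j => bit z j.*2.+1))).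

(* The inverse of [dpoint] is h-Hoelder from the dust onto [0, 1), which bounds the
   dimension of the dust from below by that of the interval times [h]. *)
Lemma dpoint_holder z z' : 0 <= z < 1 -> 0 <= z' < 1 ->
  `|z - z'| <= G^-1 `^ h * (edist (dpoint z) (dpoint z')) `^ h.
Proof.
move=> zi zi'.
have [->|zz'] := eqVneq z z'.
  by rewrite subrr normr0 mulr_ge0// powR_ge0.
have ex : exists j, (bit z j.*2 != bit z' j.*2) || (bit z j.*2.+1 != bit z' j.*2.+1).
  apply: contrapT => /forallNP H.
  have bz m : bit z m = bit z' m.
    have /negP := H m./2; rewrite negb_or !negbK => /andP[/eqP b0 /eqP b1].
    by rewrite -(odd_double_half m); case: (odd m).
  have d n : `|z - z'| <= 2^-1 ^+ n.
    by rewrite exprVn; apply: same_bits_dist => // m _.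
  have p : 0 < `|z - z'| / 2 by rewrite divr_gt0// normr_gt0 subr_eq0.
  have x1 : 2^-1 < 1 :> R by lra.
  have x0 : 0 <= 2^-1 :> R by lra.
  have [N _ /(_ N (leqnn N))/=] := exprn_small x0 x1 p.
  by have := d N; move: p; move: (`|z - z'|) => w; lra.
have [n nP nmin] := ex_minnP ex.
have agree j : (j < n)%N -> bit z j.*2 = bit z' j.*2 /\ bit z j.*2.+1 = bit z' j.*2.+1.
  move=> jn; have : ~~ ((bit z j.*2 != bit z' j.*2) || (bit z j.*2.+1 != bit z' j.*2.+1)).
    by apply/negP => /nmin; rewrite leqNgt jn.
  by rewrite negb_or !negbK => /andP[/eqP ? /eqP ?].
have zd : `|z - z'| <= (2 ^+ n.*2)^-1.
  apply: same_bits_dist => // m mn.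
  have mh : (m./2 < n)%N by rewrite ltn_half_double.
  have [b0 b1] := agree _ mh.
  by rewrite -(odd_double_half m); case: (odd m).
have sep : G * l ^+ n <= edist (dpoint z) (dpoint z').
  case/orP: nP => ne.
    apply: le_trans (edist_ge_fst _ _).
    exact: (@psum_separated (fun j => bit z j.*2) (fun j => bit z' j.*2) n
      (fun j jn => (agree j jn).1) ne).
  apply: le_trans (edist_ge_snd _ _).
  exact: (@psum_separated (fun j => bit z j.*2.+1) (fun j => bit z' j.*2.+1) n
    (fun j jn => (agree j jn).2) ne).
apply: le_trans zd _.
(* The relation 4 l^h = 1 converts [2n] common binary digits into the scale of generation [n]. *)
have -> : (2 ^+ n.*2)^-1 = (l ^+ n) `^ h.
  by rewrite powR_exprn// lh -mul2n exprM exprVn; congr (_ ^+ _)^-1; ring.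
have ln0 : 0 <= l ^+ n by rewrite exprn_ge0// ltW.
rewrite -powRM ?invr_ge0 ?(ltW G0) ?sqrtr_ge0//.
apply: ge0_ler_powR; rewrite ?nnegrE ?(ltW h0)//.
  by rewrite mulr_ge0 ?invr_ge0 ?(ltW G0) ?sqrtr_ge0.
by rewrite ler_pdivlMl.
Qed.

(** A cover of the dust is pulled back by [dpoint] to a cover of [[0, 1)]. The pieces have diameter
    at most [C] times the power [s] of the original ones, as diameters are at most 1 and [s < h];
    Lebesgue measure is countably subadditive. *)
Lemma hausdorff_approx_dust_ge s : 0 < s -> s < h ->
  ((2 * G^-1 `^ h)^-1%:E <= hausdorff_approx s 1 dust)%E.
Proof.
move=> s0 sh; apply: le_ereal_inf_tmp => _ [F [FE F1] <-].
pose d i := fine (diam (F i)).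
have dE i : diam (F i) = (d i)%:E.
  by rewrite fineK// ge0_fin_numE ?diam_ge0// (le_lt_trans (F1 i))// ltry.
have d0 i : 0 <= d i by rewrite -lee_fin -dE diam_ge0.
have d1 i : d i <= 1 by rewrite -lee_fin -dE.
pose C := G^-1 `^ h.
have C0 : 0 < C by rewrite powR_gt0// invr_gt0.
pose D i := [set z : R | 0 <= z < 1 /\ F i (dpoint z)].
have DC i z z' : D i z -> D i z' -> `|z - z'| <= C * d i `^ s.
  move=> [zi Fz] [zi' Fz']; apply: le_trans (dpoint_holder zi zi') _.
  rewrite ler_wpM2l ?(ltW C0)//.
  have ed : edist (dpoint z) (dpoint z') <= d i.
    by rewrite -lee_fin -dE; exact: edist_le_diam.
  apply: (@le_trans _ _ (d i `^ h)).
    by apply: ge0_ler_powR; rewrite ?nnegrE ?(ltW h0) ?sqrtr_ge0.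
  have [->|di0] := eqVneq (d i) 0; first by rewrite !powR0// gt_eqF.
  by apply: ger_powR; [rewrite lt0r di0 d0 d1|exact: ltW].
(* An arbitrary set [D i] is enclosed in an interval centred at one of its points, which is
   measurable; this costs the factor 2. *)
pose I i : set R := if pselect (exists z, D i z) is left P
  then `[projT1 (cid P) - C * d i `^ s, projT1 (cid P) + C * d i `^ s]%classic
  else set0.
have mI i : measurable (I i).
  by rewrite /I; case: pselect => // P; exact: measurable_itv.
have DI i : D i `<=` I i.
  move=> z Dz; rewrite /I; case: pselect => [P|[]]; last by exists z.
  case: (cid P) => z' Dz' /=; have := DC i _ _ Dz Dz'.
  by rewrite ler_norml in_itv/= => /andP[? ?]; apply/andP; split; lra.
have lI i : (lebesgue_measure (I i) <= (2 * C * d i `^ s)%:E)%E.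
  have p0 : 0 <= d i `^ s by exact: powR_ge0.
  rewrite /I; case: pselect => P; last first.
    by rewrite measure0 lee_fin !mulr_ge0// ltW.
  case: (cid P) => w _ /=; rewrite lebesgue_measure_itv/=; case: ifP => _; last first.
    by rewrite lee_fin !mulr_ge0// ltW.
  by rewrite -EFinB lee_fin; lra.
have cov : `[0, 1[%classic `<=` \bigcup_i I i.
  move=> z /=; rewrite in_itv/= => zi.
  have [i _ Fi] := FE _ (@dust_limit (fun j => bit z j.*2) (fun j => bit z j.*2.+1)).
  by exists i => //; apply: DI.
have := @measure_sigma_subadditive _ _ _ (@lebesgue_measure R) _ _ mI
  (measurable_itv `[0, 1[) cov.
have L1 : lebesgue_measure (`[0, 1[%classic : set R) = 1%E.
  by rewrite lebesgue_measure_itv/= lte_fin ltr01 sube0.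
rewrite [X in (X <= _)%E -> _](_ : _ = 1%E); last exact: L1.
move=> one_le.
have {}one_le : (1%:E <= (2 * C)%:E * \sum_(0 <= i <oo) (d i `^ s)%:E)%E.
  rewrite -nneseriesZl; last by move=> i _; rewrite lee_fin powR_ge0.
  apply: le_trans one_le _; apply: lee_nneseries => [i _ _|i _] //.
  by apply: le_trans (lI i) _.
have C2 : 0 < 2 * C by rewrite mulr_gt0.
by rewrite -[leLHS]mule1 lee_pdivrMl//; exact: one_le.
Qed.

End lower_bound.

Lemma hausdorff_dim_dust : hausdorff_dim dust = h%:E.
Proof.
apply/eqP; rewrite eq_le; apply/andP; split.
  apply/lee_addgt0Pr => e e0; rewrite -EFinD.
  apply: ereal_inf_lbound; exists (h + e) => //; split; first by rewrite addr_gt0.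
  by apply: hausdorff_measure_dust; rewrite ltrDl.
apply: le_ereal_inf_tmp => _ [s [s0 Hs] <-]; rewrite lee_fin leNgt; apply/negP => sh.
have := hausdorff_approx_dust_ge s0 sh; apply/negP; rewrite -ltNge.
apply: (@le_lt_trans _ _ (hausdorff_measure s dust)).
  by apply: ereal_sup_ubound; exists 1 => //=.
by rewrite Hs lte_fin invr_gt0 mulr_gt0// powR_gt0// invr_gt0.
Qed.

End cantor_dust.

Lemma lipschitz_continuous {R : realType} {V : normedModType R} (F : V -> R) :
  lipschitz_fun F -> continuous F.
Proof.
move=> [B BF] x; apply/cvgrPdist_le => e e0.
have b0 : 0 < `|B| + 1 by rewrite ltr_wpDl.
near=> y; apply: le_trans (BF x y) _.
apply: (@le_trans _ _ ((`|B| + 1) * `|x - y|)).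
  by rewrite ler_wpM2r// (le_trans (ler_norm B))// lerDl.
rewrite mulrC -ler_pdivlMr//; near: y.
by apply: cvgr_dist_le; [exact: cvg_id|rewrite divr_gt0].
Unshelve. all: by end_near. Qed.

(** * The field is weakly divergence free *)

Section solenoidal.
Context {R : realType} (l : R) (l0 : 0 < l) (l1 : l < 2^-1).

(* At each time at most one stage is active. *)
Lemma tvel_cases t : 0 < t -> (forall x y, tvel l t x y = 0) \/
  exists k, forall x y, tvel l t x y = vel l k t x y.
Proof.
move=> t0; have Lt := level_le l0 l1 t0.
have [[k kt]|none] := pselect (exists k, dspread l k t != 0); last first.
  left=> x y; rewrite /tvel /pvel big1// => k _.
  suff -> : vel l k t x y = 0 by [].
  rewrite /vel; have [->|dk] := eqVneq (dspread l k t) 0; first by rewrite mul0r.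
  by exfalso; apply: none; exists k.
right; exists k => x y; pose K := maxn (level l t) k.+1.
have Kt : tim l K <= t by apply: le_trans Lt; apply: tim_anti => //; exact: leq_maxl.
rewrite (tvelE l0 l1 _ _ Kt) /pvel.
have kK : (k < K)%N by exact: leq_maxr.
rewrite (bigD1 (Ordinal kK))//= big1 ?addr0// => j jk.
rewrite /vel; have [->|dj] := eqVneq (dspread l j t) 0; first by rewrite mul0r.
exfalso; move/negP: jk; apply; apply/eqP/val_inj => /=.
exact: (dspread_inj l0 l1 dj kt).
Qed.

Lemma far_outside k x : 4 * scl l k <= `|x| -> outside l k x.
Proof.
have s0 := scl_gt0 l0 k; case: (leP 0 x) => x0 xs.
  by rewrite ger0_norm// in xs; right.
by rewrite ltr0_norm// in xs; left; lra.
Qed.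

(** When a stage is active, its stream function is a difference of two products, [step] in one
    variable times [lin] in the other, and each product is handled by [integral_skew]. *)
Lemma field_weakly_div_free : weakly_div_free (field l).
Proof.
move=> t t0 psi [spsi _]; rewrite /field/=.
have [t0'|t0'] := leP t 0.
  by apply: integral0_eq => z _; rewrite !tvel_le0//= !mul0r addr0.
have [E|[k E]] := tvel_cases t0'.
  by apply: integral0_eq => z _; rewrite !E !mul0r addr0.
have hT : lipschitz_fun (fun _ : R => t) by exact: lipschitz_cst.
have hX : lipschitz_fun (fun x : R => x) by exists 1 => p q; rewrite mul1r.
have clin : continuous (dlin l k).
  exact/lipschitz_continuous/bounded_lipschitz_fun/(bounded_lipschitz_dlin l0 l1 hX).
have cstep : continuous (dstep l k t).
  apply/lipschitz_continuous/bounded_lipschitz_fun/bounded_lipschitzD;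
    apply: bounded_lipschitzM.
  - exact: (bounded_lipschitz_dcut l hX).
  - exact: (bounded_lipschitz_stair l hT hX k).
  - exact: (bounded_lipschitz_cut l0 l1 hX).
  - exact: (bounded_lipschitz_dstair l hT hX k).
have olin x : 4 * scl l k <= `|x| -> lin l k x = 0 /\ dlin l k x = 0.
  by move=> /far_outside; exact: lin_out.
have ostep x : 4 * scl l k <= `|x| -> step l k t x = 0 /\ dstep l k t x = 0.
  by move=> /far_outside; exact: step_out.
have dlin' := @is_derive_lin R l k; have dstep' := @is_derive_step R l k t.
have i1 := integrable_skew dstep' cstep dlin' clin ostep olin spsi.
have i2 := integrable_skew dlin' clin dstep' cstep olin ostep spsi.
have e1 := integral_skew dstep' cstep dlin' clin ostep olin spsi.
have e2 := integral_skew dlin' clin dstep' cstep olin ostep spsi.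
set S1 := skew_integrand _ _ _ _ _ in i1 e1; set S2 := skew_integrand _ _ _ _ _ in i2 e2.
transitivity (\int[(@lebesgue_measure R \x @lebesgue_measure R)%E]_z
    ((dspread l k t)%:E * ((EFin \o S1) z - (EFin \o S2) z)))%E.
  apply: eq_integral => z _; rewrite !E /= -EFinB -EFinM; congr EFin.
  by rewrite /S1 /S2 /skew_integrand /vel; case: z => x y /=; ring.
rewrite integralZl//; last exact: integrableB.
by rewrite integralB// [X in (X - _)%E]e1 [X in (_ - X)%E]e2 subee// mule0.
Qed.

End solenoidal.

(** * The advected measure *)

Section support.
Context {R : realType}.

(** As every label has positive mass, an open set is charged exactly when it contains a particle. *)
Lemma msupp_cloud (X Y : nat -> R -> R) (nu : {finite_measure set nat -> \bar R}) (t : R) :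
  (forall n, (0 < nu [set n])%E) ->
  msupp (cloud_measure X Y nu t) = closure (range (cloud X Y t)).
Proof.
move=> nu0; apply/seteqP; split => x.
  move=> xs B; rewrite nbhsE => -[U [oU Ux] UB]; have := xs U oU Ux; rewrite cloud_measureE => U0.
  have [n Un] : (cloud X Y t @^-1` U) !=set0.
    by apply/set0P/eqP => E; rewrite E measure0 ltxx in U0.
  by exists (cloud X Y t n); split; [exists n|exact: UB].
move=> xc U oU Ux; rewrite cloud_measureE.
have [_ [[n _ <-] Un]] := xc U (open_nbhs_nbhs (conj oU Ux)).
apply: lt_le_trans (nu0 n) _; apply: le_measure; rewrite ?inE//.
by move=> _ ->.
Qed.

Lemma poisson_gt0 n : (0 < (poisson_prob (1 : R) 0 : set nat -> \bar R) [set n])%E.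
Proof.
rewrite /poisson_prob ltr01 esum_set1.
  by rewrite lte_fin /poisson_pmf ltr01 !mulr_gt0 ?exprn_gt0 ?expR_gt0// invr_gt0 ltr0n fact_gt0.
by rewrite lee_fin poisson_pmf_ge0.
Qed.

End support.

Section trajectories.
Context {R : realType} (l : R) (l0 : 0 < l) (l1 : l < 2^-1).

(* Every finite word is [word n] for some [n]; the [n] that encode nothing give the
   empty word, i.e. a particle at rest at the origin. *)
Definition word (n : nat) : seq (bool * bool) := odflt [::] (unpickle n).
Definition xtraj n t : R :=
  position l (fun j => (nth (false, false) (word n) j).1) (size (word n)) t.
Definition ytraj n t : R :=
  position l (fun j => (nth (false, false) (word n) j).2) (size (word n)) t.
(* Any finite measure charging every label would do in place of Poisson's. *)
Definition omega (t : R) : {measure set (R * R) -> \bar R} :=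
  cloud_measure xtraj ytraj (poisson_prob (1 : R) 0) t.

Lemma range_cloud t : range (cloud xtraj ytraj t) =
  [set z | exists e e' n, z = (psum (fun j => weight l j t) e n, psum (fun j => weight l j t) e' n)].
Proof.
apply/seteqP; split => [_ [n _ <-]|_ [e [e' [n ->]]]]; first by do 3 eexists.
exists (pickle (mkseq (fun j => (e j, e' j)) n)) => //.
rewrite /cloud /xtraj /ytraj /word pickleK/= size_mkseq; congr (_, _).
  by apply: eq_bigr => j _; rewrite nth_mkseq.
by apply: eq_bigr => j _; rewrite nth_mkseq.
Qed.

Lemma msupp_omega t : msupp (omega t) = dust (fun j => weight l j t).
Proof. by rewrite msupp_cloud ?range_cloud//; exact: poisson_gt0. Qed.

End trajectories.

(** * Choice of the contraction ratio and construction of the solution *)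

(** The ratio is 4^(-1/h). If it were at least 1/2, then 2^(-h) would be at most 2^(-2), against
    [h < 2]. *)
Lemma contraction_ratio {R : realType} (h : R) : 0 < h -> h < 2 ->
  exists l : R, [/\ 0 < l, l < 2^-1 & l `^ h = 4^-1].
Proof.
move=> h0 h2; have q0 : 0 < 4^-1 :> R by lra.
have lh : (4^-1 `^ h^-1) `^ h = 4^-1 :> R.
  by rewrite -powRrM mulVf ?gt_eqF// powRr1// ltW.
exists (4^-1 `^ h^-1); split; [exact: powR_gt0| |exact: lh].
rewrite ltNge; apply/negP => hl.
have b0 : 0 < 2^-1 :> R by lra.
have : 2^-1 `^ h <= 4^-1 :> R.
  rewrite -lh; apply: ge0_ler_powR; rewrite ?nnegrE ?powR_ge0//; exact: ltW.
have -> : 4^-1 = 2^-1 `^ h * 2^-1 `^ (2 - h) :> R.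
  rewrite -powRD; last by apply/implyP => _; rewrite gt_eqF.
  by rewrite addrC subrK powR_mulrn ?(ltW b0)// expr2; field.
rewrite ler_pMr ?powR_gt0// leNgt => /negP; apply.
have e1 : 1 `^ (2 - h) = 1 :> R by rewrite powR1.
rewrite -[ltRHS]e1; apply: gt0_ltr_powR; rewrite ?nnegrE ?subr_gt0//; lra.
Qed.

Unset Implicit Arguments.

Theorem theorem1 (R : realType) (h : R) (h1 : 1 < h) (h2 : h < 2) :
  exists (u : R * (R * R) -> R * R) (omega : R -> {measure set (R * R) -> \bar R}),
    [/\ {within halfspace, continuous u},
        unif_cont_on halfspace u,
        (exists K : set (R * (R * R)), compact K /\
           forall p, halfspace p -> ~ K p -> u p = 0),
        weakly_div_free u &
        loc_lipschitz_on (halfspace `\ (0, (0, 0))) u] /\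
    [/\ (forall t, 0 <= t -> locally_finite (omega t)),
        (forall T, 0 < T -> weakly_advected T omega u),
        msupp (omega 0) = [set (0, 0)] &
        (forall t, 0 < t -> hausdorff_dim (msupp (omega t)) = h%:E)].
Proof.
have h0 : 0 < h := lt_trans ltr01 h1.
have [l [l0 l1 lh]] := contraction_ratio h0 h2.
exists (field l), (omega l); split; split.
- exact: continuous_subspaceT (continuous_field l0 l1).
- move=> e e0; have [d d0 H] := field_uniformly_continuous l0 l1 e0.
  by exists d => // p q _ _; exact: H.
- have [K [cK HK]] := field_compact_support l0 l1.
  by exists K; split => // p _; exact: HK.
- exact: field_weakly_div_free.
- apply: (field_locally_lipschitz l0 l1) => -[t z] [/= t0 tz].
  rewrite /halfspace/= in t0; move: t0; rewrite le_eqVlt => /orP[/eqP t0|->]; last by left.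
  by right; apply/eqP => z0; apply: tz; rewrite -t0 z0.
- move=> t _ x; exists setT; split => //; first exact: openT.
  rewrite (_ : omega l t setT = 1%E) ?ltry//.
  exact: (@probability_setT _ _ _ (poisson_prob (1 : R) 0)).
- move=> T T0; apply: (@advected _ (field l) (xtraj l) (ytraj l) 2 _
    (continuous_field l0 l1)) => //.
  + by move=> n; exact: continuous_position.
  + by move=> n; exact: continuous_position.
  + by move=> n t; rewrite ger0_norm ?position_ge0// position_le2.
  + by move=> n t; rewrite ger0_norm ?position_ge0// position_le2.
  + by move=> n t t0; exact: position_ode.
  + by move=> n t t0; exact: position_ode.
- rewrite msupp_cloud; last exact: poisson_gt0.
  have -> : range (cloud (xtraj l) (ytraj l) 0) = [set (0, 0)].
    apply/seteqP; split => [_ [n _ <-]|_ ->].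
      by rewrite /cloud /xtraj /ytraj !position_le0.
    by exists 0%N => //; rewrite /cloud /xtraj /ytraj !position_le0.
  apply/esym/closure_id; apply: accessible_closed_set1; apply: hausdorff_accessible.
  exact: norm_hausdorff.
- move=> t t0; rewrite (msupp_omega l).
  (* The separation constant depends on the time, the dimension does not. *)
  have [G G0 gap] := weight_gap l0 l1 t0.
  apply: (hausdorff_dim_dust l0 l1 h0 lh _ _ G0 gap) => j.
    exact: weight_ge0.
  exact: weight_le.
Qed.
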